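(* Let $q=p^m$ and let $\pi$ be a quadratic ordinary Weil $q$-number, satisfying $\pi^2+B\pi+q=0$ with $B\in\mathbb Z$, $p\nmid B$, and let $D=B^2-4q$, with $-4q<D<0$. Let $$\tau_0=\begin{pmatrix}-1&0\\0&1\end{pmatrix},\qquad\tau_1=\begin{pmatrix}-1&0\\1&1\end{pmatrix}.$$ Over $\mathbb F_q$, the number of (real isomorphism classes of) principally polarized Deligne modules $(T,F,\lambda,\eta)$ with real structure $\eta$ and rank $2$, such that the eigenvalues of $F$ are $\{\pi,\bar\pi\}$, which correspond to the cohomology class of $\tau_0$ is $\sigma_0(-D/4)$ if $D\equiv0\pmod 4$ and is $0$ otherwise, where $\sigma_0(m)$ denotes the number of positive divisors of $m>0$. The number of isomorphism classes which correspond to the cohomology class of $\tau_1$ is $\sigma_0(-D)$ if $D\equiv1\pmod4$, and is $\sigma_0'(-D/4)$ if $D\equiv 0\pmod4$, where $\sigma'_0(m)$ denotes the number of ordered factorizations $m=uv$ such that $u,v>0$ have the same parity.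
   Context: A Deligne module of rank $2$ over $\mathbb F_q$ is a pair $(T,F)$, $T\cong\mathbb Z^2$, $F\in\mathrm{End}(T)$ semisimple with complex eigenvalues of absolute value $\sqrt q$, exactly one of its two eigenvalues in $\overline{\mathbb Q}_p$ being a $p$-adic unit and the other divisible by $q$, trace coprime to $p$, and such that there is $V\in\mathrm{End}(T)$ with $FV=VF=q$. Fix an embedding $\varepsilon:W(\overline{\mathbb F}_q)\to\mathbb C$; it determines a valuation $\mathrm{val}_p$ on $\overline{\mathbb Q}\subset\mathbb C$, and the CM type $\Phi_\varepsilon$ on $\mathbb Q[F]$ is the set of $\phi:\mathbb Q[F]\to\mathbb C$ with $\mathrm{val}_p(\phi(F))>0$. A polarization is an alternating form $\lambda:T\times T\to\mathbb Z$, nondegenerate over $\mathbb Q$, with $\lambda(Fx,y)=\lambda(x,Vy)$ and $\lambda(x,\iota y)$ symmetric positive definite for $\iota\in\mathbb Q[F]$ with $\bar\iota=-\iota$ and $\phi(\iota)$ positive imaginary for $\phi\in\Phi_\varepsilon$; it is principal if it induces $T\cong\mathrm{Hom}(T,\mathbb Z)$. A real structure is $\eta:T\to T$ with $\eta^2=I$, $\eta F\eta^{-1}=V$, $\lambda(\eta x,\eta y)=-\lambda(x,y)$. Isomorphisms are group isomorphisms commuting with $F$ and $\eta$ and preserving $\lambda$. Choosing a symplectic basis of $(T,\lambda)$ (identifying $\lambda$ with the standard form on $\mathbb Z^2$), $\eta$ becomes an involution in $\mathrm{GL}_2(\mathbb Z)$ of determinant $-1$, well defined up to $\mathrm{SL}_2(\mathbb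 Z)$-conjugacy; each such involution is $\mathrm{SL}_2(\mathbb Z)$-conjugate to exactly one of $\tau_0,\tau_1$, and the module is said to correspond to the cohomology class of that involution. *)

(* Defs.v *)
From HB Require Import structures.
From mathcomp Require Import all_boot all_order all_algebra.
From mathcomp Require Import reals.
From mathcomp Require Import complex.

Set Implicit Arguments.
Unset Strict Implicit.
Unset Printing Implicit Defensive.

Import Order.TTheory GRing.Theory Num.Theory.
Local Open Scope ring_scope.

(* [strict_p_ring p r] : W is p-torsion free, the surjection r : W -> k has   *)
(* kernel pW, and W is p-adically complete and separated (existence, resp.    *)
(* uniqueness, of limits).  For k a perfect field of characteristic p this    *)
(* characterizes the ring of Witt vectors W(k), up to unique isomorphism over *)
(* k; for k = 'F_p it is the ring Z_p.                                        *)
Definition strict_p_ring (p : nat) (k : fieldType) (W : comNzRingType)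
    (r : {rmorphism W -> k}) : Prop :=
  [/\ forall y : k, exists x : W, r x = y,
      forall x : W, r x = 0 <-> exists y : W, x = p%:R * y,
      forall x : W, p%:R * x = 0 -> x = 0
    & forall u : nat -> W,
        (forall n, exists y, u n.+1 - u n = p%:R ^+ n * y) ->
        exists! x, forall n, exists y, x - u n = p%:R ^+ n * y].

(* The library's [algebraicOver], for a base which need not be a field. *)
Definition alg_over (A L : nzRingType) (f : A -> L) (z : L) : Prop :=
  exists2 P : {poly A}, P != 0 & root (map_poly f P) z.

(* An algebraic closure of Q_p: it is algebraic over (the fraction field of)  *)
(* the image of Z_p.                                                          *)
Record padic_closure (p : nat) := PadicClosure {
  Zp_ : comNzRingType;
  Zp_red : {rmorphism Zp_ -> 'F_p};
  Zp_strict : strict_p_ring p Zp_red;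
  Qp_bar : closedFieldType;
  Zp_inj : {rmorphism Zp_ -> Qp_bar};
  Zp_injP : injective Zp_inj;
  Qp_bar_alg : forall x : Qp_bar, alg_over Zp_inj x
}.

(* The ring of integers of Q_p-bar is the integral closure of Z_p in it.      *)
Definition padic_int (p : nat) (K : padic_closure p) (x : Qp_bar K) : Prop :=
  integralOver (Zp_inj K) x.

Definition padic_unit (p : nat) (K : padic_closure p) (x : Qp_bar K) : Prop :=
  [/\ x != 0, padic_int x & padic_int x^-1].

Definition padic_dvd (p : nat) (K : padic_closure p) (y x : Qp_bar K) : Prop :=
  exists2 z : Qp_bar K, padic_int z & x = y * z.

(* An embedding eps : W(F_q-bar) -> C. *)
Record witt_embedding (R : realType) (p q : nat) := WittEmbedding {
  we_Fq : finFieldType;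
  we_card : #|we_Fq| = q;
  we_Fqbar : closedFieldType;
  we_inj : {rmorphism we_Fq -> we_Fqbar};
  we_alg : forall x : we_Fqbar, algebraicOver we_inj x;
  we_W : comNzRingType;
  we_red : {rmorphism we_W -> we_Fqbar};
  we_strict : strict_p_ring p we_red;
  eps : {rmorphism we_W -> R[i]};
  eps_inj : injective eps
}.

(* v restricts to the p-adic valuation (normalized by v p = 1) on             *)
(* eps(W(F_q-bar)), hence is its unique extension to the algebraic closure of *)
(* the fraction field of that ring in C.  This closure contains Q-bar, and    *)
(* val_p is the restriction of v to Q-bar.  The valuation of 0 is +oo, so the *)
(* value v 0 is junk, as are the values of v off the algebraic closure.       *)
Definition is_val_p (R : realType) (p q : nat) (E : witt_embedding R p q)
    (v : R[i] -> rat) : Prop :=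
  let K x := x != 0 /\ alg_over (eps E) x in
  [/\ v p%:R = 1,
      forall w : we_W E, w != 0 -> 0 <= v (eps E w),
      forall x y, K x -> K y -> v (x * y) = v x + v y
    & forall x y, K x -> K y -> x + y != 0 -> Num.min (v x) (v y) <= v (x + y)].

Definition weil_number (R : realType) (q : nat) (x : R[i]) : Prop :=
  integralOver (intr : int -> R[i]) x /\
  forall y : R[i],
    (forall P : {poly rat},
       root (map_poly ratr P) x -> root (map_poly ratr P) y) ->
    `|y| = sqrtC q%:R.

(* The subring Q[A] of the ring of 2 x 2 rational matrices. *)
Definition in_QF (A X : 'M[rat]_2) : Prop :=
  exists P : {poly rat}, X = horner_mx A P.

(* phi is (a function whose restriction to Q[A] is) a ring homomorphism       *)
(* Q[A] -> C; values of phi off Q[A] are irrelevant.                          *)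
Definition QF_hom (R : realType) (A : 'M[rat]_2)
    (phi : 'M[rat]_2 -> R[i]) : Prop :=
  [/\ phi 1 = 1,
      forall X Y, in_QF A X -> in_QF A Y -> phi (X + Y) = phi X + phi Y
    & forall X Y, in_QF A X -> in_QF A Y -> phi (X * Y) = phi X * phi Y].

(* Y is the complex conjugate of X in the CM algebra Q[A]: the element which  *)
(* is sent to the complex conjugate of phi X by every phi : Q[A] -> C.        *)
Definition QF_conj (R : realType) (A X Y : 'M[rat]_2) : Prop :=
  [/\ in_QF A X, in_QF A Y
    & forall phi : 'M[rat]_2 -> R[i], QF_hom A phi -> phi Y = (phi X)^*].

Definition CM_type (R : realType) (v : R[i] -> rat) (A : 'M[rat]_2)
    (phi : 'M[rat]_2 -> R[i]) : Prop :=
  QF_hom A phi /\ 0 < v (phi A).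

Definition pos_imaginary (R : realType) (z : R[i]) : Prop :=
  exists2 y : R, 0 < y & z = Complex 0 y.

(* Matrices act on column vectors, hence the transposes: the row space of U   *)
(* is a space of column vectors, and it is mapped by A into itself.           *)
Definition semisimple_mx (A : 'M[rat]_2) : Prop :=
  forall U : 'M[rat]_2, stablemx U A^T ->
  exists W : 'M[rat]_2,
    [/\ stablemx W A^T, (U :&: W == (0 : 'M[rat]_2))%MS
      & (U + W == 1%:M)%MS].

Section Modules.
Variables (R : realType) (p q : nat) (K : padic_closure p) (v : R[i] -> rat).

(* The matrix of an endomorphism of T in coordinates T = Z^2. *)
Definition coord_mx (T : zmodType) (c : T -> 'cV[int]_2) (d : 'cV[int]_2 -> T)
    (f : T -> T) : 'M[int]_2 :=
  \matrix_(i, j) c (f (d (delta_mx j 0))) i 0.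

(* The coordinates only witness that T is isomorphic to Z^2; isomorphisms     *)
(* (see [dm_isom]) are not required to respect them.  V is determined by F.   *)
Record deligne_module := DeligneModule {
  dmT :> zmodType;
  toZ2 : {additive dmT -> 'cV[int]_2};
  ofZ2 : 'cV[int]_2 -> dmT;
  toZ2K : cancel toZ2 ofZ2;
  ofZ2K : cancel ofZ2 toZ2;
  dmF : {additive dmT -> dmT};
  dmV : {additive dmT -> dmT};
  dmFV : forall x, dmF (dmV x) = x *+ q;
  dmVF : forall x, dmV (dmF x) = x *+ q;
  dm_mx := coord_mx toZ2 ofZ2 dmF;
  dm_semisimple : semisimple_mx (map_mx intr dm_mx);
  dm_weil : forall z : R[i],
    eigenvalue (map_mx intr dm_mx : 'M[R[i]]_2) z -> `|z| = sqrtC q%:R;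
  dm_ordinary : exists a b : Qp_bar K,
    [/\ map_poly intr (char_poly dm_mx) = ('X - a%:P) * ('X - b%:P),
        padic_unit a, ~ padic_unit b & padic_dvd q%:R b];
  dm_trace : coprimez (\tr dm_mx) p
}.

Definition mxF (M : deligne_module) : 'M[int]_2 :=
  coord_mx (@toZ2 M) (@ofZ2 M) (dmF M).
Definition mxFQ (M : deligne_module) : 'M[rat]_2 := map_mx intr (mxF M).

(* The Q-bilinear extension of lam to T (x) Q = Q^2. *)
Definition formQ (M : deligne_module) (lam : M -> M -> int)
    (x y : 'cV[rat]_2) : rat :=
  let e i : M := ofZ2 M (delta_mx i 0) in
  \sum_i \sum_j x i 0 * (lam (e i) (e j))%:~R * y j 0.

Definition positive_form (M : deligne_module) (lam : M -> M -> int) : Prop :=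
  forall iota : 'M[rat]_2,
    QF_conj R (mxFQ M) iota (- iota) ->
    (forall phi, CM_type v (mxFQ M) phi -> pos_imaginary (phi iota)) ->
    (forall x y, formQ lam x (iota *m y) = formQ lam y (iota *m x)) /\
    (forall x, x != 0 -> 0 < formQ lam x (iota *m x)).

Record is_polarization (M : deligne_module) (lam : M -> M -> int) : Prop :=
  IsPolarization {
  pol_addl : forall x y z, lam (x + y) z = lam x z + lam y z;
  pol_addr : forall x y z, lam x (y + z) = lam x y + lam x z;
  pol_alt : forall x, lam x x = 0;
  pol_nondeg : forall x, (forall y, formQ lam x y = 0) -> x = 0;
  pol_FV : forall x y, lam (dmF M x) y = lam x (dmV M y);
  pol_pos : positive_form lam
}.

Definition is_principal (M : deligne_module) (lam : M -> M -> int) : Prop :=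
  forall f : {additive M -> int}, exists! x : M, forall y, lam x y = f y.

Record is_real_structure (M : deligne_module) (lam : M -> M -> int)
    (eta : M -> M) : Prop := IsRealStructure {
  real_add : forall x y, eta (x + y) = eta x + eta y;
  real_invol : forall x, eta (eta x) = x;
  real_FV : forall x, eta (dmF M (eta x)) = dmV M x;
  real_lam : forall x y, lam (eta x) (eta y) = - lam x y
}.

Record real_ppdm := RealPPDM {
  rdm :> deligne_module;
  rlam : rdm -> rdm -> int;
  reta : rdm -> rdm;
  rlam_pol : is_polarization rlam;
  rlam_principal : is_principal rlam;
  reta_real : is_real_structure rlam reta
}.

Definition dm_isom (M N : real_ppdm) : Prop :=
  exists f : {additive M -> N},
    [/\ bijective f,
        forall x, f (dmF M x) = dmF N (f x),
        forall x, f (reta x) = reta (f x)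
      & forall x y, rlam (f x) (f y) = rlam x y].

Definition has_eigenvalues (M : deligne_module) (a b : R[i]) : Prop :=
  forall z : R[i],
    eigenvalue (map_mx intr (mxF M) : 'M[R[i]]_2) z <-> z = a \/ z = b.

(* The matrix of the standard symplectic form. *)
Definition symp_mx : 'M[int]_2 :=
  \matrix_(i, j) (if (i == 0) && (j == 1) then 1
                  else if (i == 1) && (j == 0) then -1 else 0).

(* g is a symplectic basis, i.e. an isomorphism from Z^2 with its standard    *)
(* symplectic form to (T, lam); B is the matrix of eta in this basis, and B   *)
(* is required to be SL_2(Z)-conjugate to tau.                                *)
Definition corresponds_to (tau : 'M[int]_2) (M : real_ppdm) : Prop :=
  exists (g : {additive 'cV[int]_2 -> M}) (B S : 'M[int]_2),
    [/\ bijective g,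
        forall x y, rlam (g x) (g y) = (x^T *m symp_mx *m y) 0 0,
        forall x, reta (g x) = g (B *m x),
        \det S = 1
      & B = S *m tau *m invmx S].

End Modules.

Arguments mxFQ {R p q K} M.

Definition tau0 : 'M[int]_2 :=
  \matrix_(i, j) (if i == j then (if i == 0 then -1 else 1) else 0).

Definition tau1 : 'M[int]_2 :=
  \matrix_(i, j) (if i == 0 then (if j == 0 then -1 else 0) else 1).

(* The elements of X satisfying P form exactly n classes for iso. *)
Definition num_classes (X : Type) (P : X -> Prop) (iso : X -> X -> Prop)
    (n : nat) : Prop :=
  exists f : 'I_n -> X,
    [/\ forall i, P (f i),
        forall i j, iso (f i) (f j) -> i = j
      & forall x, P x -> exists i, iso x (f i)].

Definition sigma0 (n : nat) : nat := size (divisors n).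

Definition sigma0' (n : nat) : nat :=
  #|[set uv : 'I_n.+1 * 'I_n.+1 |
      [&& (0 < uv.1)%N, (0 < uv.2)%N, (uv.1 * uv.2 == n)%N
        & odd uv.1 == odd uv.2]]|.

(* Main.v *)
Require Import Defs.
From HB Require Import structures.
From mathcomp Require Import all_boot all_order all_algebra.
From mathcomp Require Import reals.
From mathcomp Require Import complex.
From mathcomp Require Import ring lra zify.

Set Implicit Arguments.
Unset Strict Implicit.
Unset Printing Implicit Defensive.

Import Order.TTheory GRing.Theory Num.Theory.
Local Open Scope ring_scope.

(** In a symplectic basis in which [eta] is [tau], the Frobenius becomes an
    integral matrix [A] of trace [-B] and determinant [q] with
    [tau A tau = adj A]; the remaining freedom is the centralizer of [tau] in
    SL_2(Z), which is {1, -1}, so that isomorphism classes are such matrices.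
    The polarization is positive exactly when the lower left entry of [A] has
    the sign of the imaginary part of the eigenvalue of positive valuation;
    the other three conditions read [A 0 1 * A 1 0 = D / 4] (with equal
    diagonal entries) for [tau0], and
    [A 0 1 * (A 0 1 + 4 * A 1 0) = D] for [tau1]. Counting the factorizations
    with the prescribed signs gives the divisor functions. *)

(** * 2 x 2 matrices *)

(** The valuation serves to single out one eigenvalue [om]: the CM type is then phi A = om, and the
    admissible iota are y (F + B / 2) with y Im om > 0. The form lam (x, iota x) has discriminant
    y^2 D < 0, so it is definite and its value y A10 at one basis vector decides positivity; this is
    why a single sign condition survives. For [tau1] the two factors of D have opposite signs and
    differ by 4 A10, so that -D = d e with the constraint 4 | d + e. The constraint is automatic for
    D = 1 modulo 4; for D = -4 n it says d = 2 u, e = 2 w with u and w of the same parity, which is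
    the origin of [sigma0']. Conversely, each matrix has to be completed to a full module. Its
    ordinarity concerns roots in a closure of Q_p with no given relation to the embedding of the
    Witt vectors in C, so it cannot be read off from [v] and is proved by Hensel's lemma over
    Z_p. *)

Lemma ord2P (i : 'I_2) : i = 0 \/ i = 1.
Proof. by case: i => [[|[|//]]] ?; [left | right]; apply: val_inj. Qed.

Lemma big_ord2 (V : nmodType) (F : 'I_2 -> V) : \sum_i F i = F 0 + F 1.
Proof. by rewrite big_ord_recl big_ord1; congr (_ + F _); apply: val_inj. Qed.

Lemma eq_mx2 (R : Type) (A B : 'M[R]_2) :
  A 0 0 = B 0 0 -> A 0 1 = B 0 1 -> A 1 0 = B 1 0 -> A 1 1 = B 1 1 -> A = B.
Proof.
by move=> *; apply/matrixP => i j; case: (ord2P i) => ->; case: (ord2P j) => ->.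
Qed.

Lemma eq_cV2 (R : Type) (x y : 'cV[R]_2) : x 0 0 = y 0 0 -> x 1 0 = y 1 0 -> x = y.
Proof.
by move=> *; apply/matrixP => i j; rewrite ord1; case: (ord2P i) => ->.
Qed.

Definition mx2 (R : Type) (a b c d : R) : 'M[R]_2 :=
  \matrix_(i, j) (if i == 0 then if j == 0 then a else b
                  else if j == 0 then c else d).

Lemma mx2_00 (R : Type) (a b c d : R) : mx2 a b c d 0 0 = a.
Proof. by rewrite mxE. Qed.
Lemma mx2_01 (R : Type) (a b c d : R) : mx2 a b c d 0 1 = b.
Proof. by rewrite mxE. Qed.
Lemma mx2_10 (R : Type) (a b c d : R) : mx2 a b c d 1 0 = c.
Proof. by rewrite mxE. Qed.
Lemma mx2_11 (R : Type) (a b c d : R) : mx2 a b c d 1 1 = d.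
Proof. by rewrite mxE. Qed.
Definition mx2E := (mx2_00, mx2_01, mx2_10, mx2_11).

Lemma mulmx2E (R : pzSemiRingType) n (A : 'M[R]_2) (B : 'M[R]_(2, n)) i j :
  (A *m B) i j = A i 0 * B 0 j + A i 1 * B 1 j.
Proof. by rewrite mxE big_ord2. Qed.

Lemma tr_mx2 (R : pzSemiRingType) (A : 'M[R]_2) : \tr A = A 0 0 + A 1 1.
Proof. by rewrite /mxtrace big_ord2. Qed.

Lemma det2 (R : comNzRingType) (A : 'M[R]_2) :
  \det A = A 0 0 * A 1 1 - A 0 1 * A 1 0.
Proof.
rewrite (expand_det_row _ 0) big_ord2 /cofactor !det_mx11 !mxE /= expr0 expr1.
have -> : lift 0 0 = 1 :> 'I_2 by apply: val_inj.
have -> : lift 1 0 = 0 :> 'I_2 by apply: val_inj.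
by ring.
Qed.

Lemma char_poly2 (R : comNzRingType) (A : 'M[R]_2) :
  char_poly A = 'X^2 - (\tr A) *: 'X + (\det A)%:P.
Proof.
rewrite det2 tr_mx2 /char_poly (det2 (char_poly_mx A)) /char_poly_mx.
rewrite !mxE /= !mulr1n !mulr0n -mul_polyC !rmorphB !rmorphD !rmorphM /=.
by ring.
Qed.

Lemma root_char_poly2 (R : comNzRingType) (A : 'M[R]_2) x :
  root (char_poly A) x = (x ^+ 2 - \tr A * x + \det A == 0).
Proof. by rewrite char_poly2 /root !hornerE. Qed.

Lemma cayley_hamilton2 (R : comNzRingType) (A : 'M[R]_2) :
  A *m A = \tr A *: A - (\det A)%:M.
Proof. by rewrite tr_mx2 det2; apply: eq_mx2; rewrite mulmx2E !mxE /=; ring. Qed.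

Definition adj2 (R : pzRingType) (A : 'M[R]_2) : 'M[R]_2 :=
  mx2 (A 1 1) (- A 0 1) (- A 1 0) (A 0 0).

Lemma mul_adj2 (R : comNzRingType) (A : 'M[R]_2) : A *m adj2 A = (\det A)%:M.
Proof. by apply: eq_mx2; rewrite mulmx2E !mx2E !mxE det2 /=; ring. Qed.

Lemma mul_adj2l (R : comNzRingType) (A : 'M[R]_2) : adj2 A *m A = (\det A)%:M.
Proof. by apply: eq_mx2; rewrite mulmx2E !mx2E !mxE det2 /=; ring. Qed.

(** * Hensel's lemma and the ordinary factorization *)

Section StrictPRing.
Variables (p : nat) (k : fieldType) (W : comNzRingType) (r : {rmorphism W -> k}).
Hypothesis Wr : strict_p_ring p r.

(** The constant sequence 0 converges both to 0 and to [x], and limits are unique. *)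
Lemma strict_p_ring_sep (x : W) :
  (forall n, exists y, x = p%:R ^+ n * y) -> x = 0.
Proof.
case: Wr => _ _ _ lim xp.
have [|z [_ z_uniq]] := lim (fun=> 0) _; first by exists 0; rewrite mulr0 subr0.
rewrite -(z_uniq x) => [|n]; last by rewrite subr0.
by apply: z_uniq => n; exists 0; rewrite mulr0 subr0.
Qed.

Lemma strict_p_ring_lim (u : nat -> W) :
  (forall n, exists y, u n.+1 - u n = p%:R ^+ n * y) ->
  exists x, forall n, exists y, x = u n + p%:R ^+ n * y.
Proof.
case: Wr => _ _ _ lim /lim[x [xu _]]; exists x => n.
by have [y xuy] := xu n; exists y; rewrite -xuy addrC subrK.
Qed.

(** [u n] is the partial sum c (1 + p t + ... + (p t)^(n-1)) of the geometric series for c / (1 - p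
    t). *)
Lemma strict_p_ring_unit (a c t : W) :
  a * c = 1 - p%:R * t -> exists a', a * a' = 1.
Proof.
move=> ac; pose u n := iter n (fun w => c + p%:R * t * w) 0.
have uS n : u n.+1 = c + p%:R * t * u n by [].
have au n : a * u n = 1 - (p%:R * t) ^+ n.
  elim: n => [|n IHn]; first by rewrite /u mulr0 expr0 subrr.
  by rewrite uS mulrDr ac mulrCA IHn exprS; ring.
have du n : u n.+1 - u n = p%:R ^+ n * (t ^+ n * c).
  elim: n => [|n IHn]; first by rewrite uS /u /= mulr0; ring.
  rewrite [u n.+2]uS {2}uS.
  have -> : c + p%:R * t * u n.+1 - (c + p%:R * t * u n)
            = p%:R * t * (u n.+1 - u n) by ring.
  by rewrite IHn !exprS; ring.
have [|x xu] := @strict_p_ring_lim u; first by move=> n; eexists; apply: du.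
exists x; apply/eqP; rewrite -subr_eq0; apply/eqP.
apply: strict_p_ring_sep => n; have [y ->] := xu n.
by exists (a * y - t ^+ n); rewrite mulrDr au exprMn; ring.
Qed.

(* Hensel's lemma at the simple root 0 of X^2 + b X + p s modulo p, by the *)
(* iteration u -> u - c f(u) with c an inverse of f'(0) = b modulo p.      *)
Lemma strict_p_ring_quadratic_root (b c s t : W) :
  b * c = 1 + p%:R * t ->
  exists y, (p%:R * y) ^+ 2 + b * (p%:R * y) + p%:R * s = 0.
Proof.
move=> bc; pose f w := w ^+ 2 + b * w + p%:R * s.
pose u n := iter n (fun w => w - c * f w) 0.
have uS n : u n.+1 = u n - c * f (u n) by [].
have fu n : exists y z, u n = p%:R * y /\ f (u n) = p%:R ^+ n.+1 * z.
  elim: n => [|n [y [z [uy fz]]]].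
    by exists 0, s; rewrite /f /u /=; split; ring.
  (* Read off from f(u - c f(u)) = f(u) (1 - b c - 2 c u + c^2 f(u)): since b c = 1 + p t and p
     divides u and f(u), the bracket is divisible by p. *)
  exists (y - c * p%:R ^+ n * z), (z * (- t - 2 * c * y + c ^+ 2 * p%:R ^+ n * z)).
  split; first by rewrite uS fz uy exprS; ring.
  have -> : f (u n.+1)
            = f (u n) * (1 - b * c - 2 * c * u n + c ^+ 2 * f (u n)).
    by rewrite uS /f; ring.
  by rewrite fz uy bc !exprS; ring.
have [n|x xu] := @strict_p_ring_lim u.
  have [y [z [uy fz]]] := fu n; exists (- c * p%:R * z).
  by rewrite uS fz exprS; ring.
have [y xy] : exists y, x = p%:R * y.
  have [y ->] := xu 1%N; have [w [z [-> _]]] := fu 1%N.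
  by exists (w + y); ring.
exists y; rewrite -xy; apply: strict_p_ring_sep => n.
have [w xw] := xu n; have [y' [z [_ fz]]] := fu n.
exists (p%:R * z + w * (x + u n + b)).
have -> : x ^+ 2 + b * x + p%:R * s = f (u n) + (x - u n) * (x + u n + b).
  by rewrite /f; ring.
by rewrite fz {1}xw exprS; ring.
Qed.

Lemma strict_p_ring_red_p : r p%:R = 0.
Proof. by case: Wr => _ /(_ p%:R)[_ ->] //; exists 1; rewrite mulr1. Qed.

End StrictPRing.

(** A monic equation for 1 / x, multiplied by a power of x, pulls back to [W] as 1 plus multiples of
    x equal to 0; its reduction reads 1 = 0. *)
Lemma nonunit_inv_not_integral (k : fieldType) (W : comNzRingType)
    (r : {rmorphism W -> k}) (L : fieldType) (i : {rmorphism W -> L}) (x : W) :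
  injective i -> r x = 0 -> i x != 0 -> ~ integralOver i (i x)^-1.
Proof.
move=> i_inj rx ix0 [P Pmon /eqP Px].
have: i (\sum_(j < size P) P`_j * x ^+ ((size P).-1 - j)) = i 0.
  rewrite rmorph0 -(mulr0 (i x ^+ (size P).-1)) -Px.
  rewrite (horner_coef_wide _ (size_poly _ _)) mulr_sumr rmorph_sum.
  apply: eq_bigr => -[j jP0] _; rewrite rmorphM rmorphXn coef_map /= mulrCA.
  have jP : (j <= (size P).-1)%N by case: (size P) jP0.
  by rewrite -{2}(subnK jP) exprD exprVn mulfK ?expf_neq0.
move/i_inj/(congr1 r); rewrite rmorph0 rmorph_sum.
have [n Pn] : exists n, size P = n.+1.
  by case: (size P) (monic_neq0 Pmon) (size_poly_eq0 P) => [|n _ _];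
     [move=> /negPf-> | exists n].
have lead : P`_n = 1 by move/monicP: Pmon; rewrite lead_coefE Pn.
rewrite Pn big_ord_recr /= subnn expr0 mulr1 lead rmorph1 big1 => [|j _].
  by rewrite add0r => /eqP; rewrite oner_eq0.
by rewrite rmorphM rmorphXn rx expr0n subn_eq0 leqNgt ltn_ord mulr0.
Qed.

(** Supplies the field [dm_ordinary] of the modules to be built. Hensel gives a root in p Z_p; the
    other root is congruent to -b modulo p, hence a unit. *)
Lemma ordinary_quadratic (p m : nat) (K : padic_closure p) (b : int) :
  prime p -> (0 < m)%N -> ~~ (p %| b)%Z ->
  exists x y : Qp_bar K,
    [/\ 'X^2 + b%:~R *: 'X + ((p ^ m)%N%:R)%:P = ('X - x%:P) * ('X - y%:P),
        padic_unit x, ~ padic_unit y & padic_dvd (p ^ m)%N%:R y].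
Proof.
move=> p_prime m_gt0 pb; set i := Zp_inj K.
have sW := Zp_strict K.
have /coprimezP[[u w] /= uw] : coprimez b p.
  by rewrite coprimezE coprime_sym prime_coprime.
have uwW : u%:~R * b%:~R + w%:~R * p%:R = 1 :> Zp_ K.
  by rewrite -[p%:R]/(p%:~R) -!intrM -intrD uw.
(* [u] inverts b modulo p, and s = p^(m-1) makes the constant term p^m. *)
have [|y y_root] := @strict_p_ring_quadratic_root _ _ _ _ sW b%:~R u%:~R
  (p%:R ^+ m.-1) (- w%:~R) _.
  by rewrite mulrC -(addrK (w%:~R * p%:R) (u%:~R * _)) uwW; ring.
set Y := p%:R * y in y_root.
have [|a' aa'] := @strict_p_ring_unit _ _ _ _ sW (- b%:~R - Y) (- u%:~R)
  (w%:~R - y * u%:~R).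
  have -> : (- b%:~R - Y) * - u%:~R = u%:~R * b%:~R + Y * u%:~R by ring.
  by rewrite -(addrK (w%:~R * p%:R) (u%:~R * _)) uwW /Y; ring.
have prod : (- b%:~R - Y) * Y = (p ^ m)%N%:R.
  rewrite natrX -(prednK m_gt0) exprS; apply/eqP.
  by rewrite -subr_eq0 -oppr_eq0 -y_root; apply/eqP; ring.
have i_inj : injective i := @Zp_injP p K.
have pm0 : (p ^ m)%N%:R != 0 :> Zp_ K.
  rewrite natrX; case: sW => _ _ torsion _.
  elim: (m) => [|n IHn]; first by rewrite expr0 oner_eq0.
  by apply: contra_neq IHn; rewrite exprS => /torsion.
have iY0 : i Y != 0.
  rewrite -(rmorph0 i); apply: contra_neq pm0 => /i_inj Y0.
  by rewrite -prod Y0 mulr0.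
have ia' : i (- b%:~R - Y) * i a' = 1 by rewrite -rmorphM aa' rmorph1.
have ia0 : i (- b%:~R - Y) != 0.
  by apply: contra_eq_neq ia' => ->; rewrite mul0r eq_sym oner_eq0.
have ia'E : (i (- b%:~R - Y))^-1 = i a'.
  by apply: (mulfI ia0); rewrite divff.
exists (i (- b%:~R - Y)), (i Y); split.
- rewrite -(rmorph_nat i) -prod -mul_polyC rmorphM /= polyCM.
  by rewrite rmorphB rmorphN rmorph_int /= !(polyCB, polyCN); ring.
- by split=> //; rewrite /padic_int ?ia'E; apply: integral_id.
- case=> _ _; apply: (@nonunit_inv_not_integral _ _ (Zp_red K)) => //.
  by rewrite rmorphM (strict_p_ring_red_p sW) mul0r.
(* The roots have product p^m, so the nonunit root is p^m times the inverse of the unit root. *)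
- exists (i a'); first exact: integral_id.
  by rewrite -(rmorph_nat i) -prod (rmorphM i _ Y) mulrAC ia' mul1r.
Qed.

(** * The valuation of the Frobenius eigenvalues *)

Section Valuation.
Variables (R : realType) (p q : nat) (E : witt_embedding R p q).
Variables (v : R[i] -> rat) (vE : is_val_p E v).

(** The axioms of addition and multiplication in [is_val_p] apply only to nonzero elements algebraic
    over the image of [eps]; this certifies the integers and the Frobenius eigenvalues. *)
Lemma alg_over_quadratic (b c : int) (x : R[i]) :
  x ^+ 2 + b%:~R * x + c%:~R = 0 -> alg_over (eps E) x.
Proof.
move=> x_root; exists ('X^2 + b%:~R%:P * 'X + c%:~R%:P).
  rewrite -size_poly_gt0 -addrA size_polyDl ?size_polyXn //.
  apply: leq_ltn_trans (size_polyD _ _) _; rewrite gtn_max.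
  rewrite (leq_ltn_trans (size_polyC_leq1 _)) // andbT.
  apply: leq_ltn_trans (size_polyMleq _ _) _; rewrite size_polyX addn2 /= ltnS.
  exact: leq_trans (size_polyC_leq1 _) _.
rewrite /root !(rmorphD, rmorphM, rmorphXn) /= map_polyX !map_polyC /=.
by rewrite !hornerE !rmorph_int x_root.
Qed.

Lemma alg_over_int (n : int) : alg_over (eps E) (n%:~R : R[i]).
Proof.
by apply: (@alg_over_quadratic (- n) 0); rewrite rmorphN rmorph0 /=; ring.
Qed.

Lemma val_int_ge0 (n : int) : n != 0 -> 0 <= v n%:~R.
Proof.
move=> n0; case: vE => _ v_ge0 _ _; rewrite -(rmorph_int (eps E)).
apply: v_ge0; apply: contra_neq n0 => /(congr1 (eps E)).
by rewrite rmorph0 rmorph_int => /eqP; rewrite intr_eq0 => /eqP.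
Qed.

Lemma val_intM (m n : int) :
  m != 0 -> n != 0 -> v (m * n)%:~R = v m%:~R + v n%:~R.
Proof.
move=> m0 n0; case: vE => _ _ vM _; rewrite intrM.
by apply: vM; split; rewrite ?intr_eq0 //; apply: alg_over_int.
Qed.

Lemma val_intD (m n : int) : m != 0 -> n != 0 -> m + n != 0 ->
  Num.min (v m%:~R) (v n%:~R) <= v (m + n)%:~R.
Proof.
move=> m0 n0 mn0; case: vE => _ _ _ vD; rewrite intrD.
apply: vD; last by rewrite -intrD intr_eq0.
  by split; rewrite ?intr_eq0 //; apply: alg_over_int.
by split; rewrite ?intr_eq0 //; apply: alg_over_int.
Qed.

Lemma val_int1 : v 1 = 0.
Proof.
by have /= := @val_intM 1 1 isT isT; rewrite mulr1 mulr1z => ?; lra.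
Qed.

Lemma val_pX m : (0 < p)%N -> v (p ^ m)%N%:R = m%:R.
Proof.
move=> p_gt0; elim: m => [|m IHm]; first by rewrite expn0 val_int1.
have vp : v p%:R = 1 by case: vE.
rewrite expnS -[RHS]/(m.+1%:R) -[m.+1]add1n natrD -IHm -vp.
by apply: (@val_intM p (p ^ m)%N); rewrite -lt0n ?expn_gt0 p_gt0.
Qed.

(** In a Bezout relation u b + w p = 1, a positive valuation of b would make both terms have
    positive valuation, while v 1 = 0. *)
Lemma val_int_coprime (b : int) : prime p -> ~~ (p %| b)%Z -> v b%:~R <= 0.
Proof.
move=> p_prime pb; have p_gt0 := prime_gt0 p_prime.
have b0 : b != 0 by apply: contraNneq pb => ->; rewrite dvdz0.
have p0 : (p : int) != 0 by rewrite -lt0n.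
have /coprimezP[[u w] /= uw] : coprimez b p.
  by rewrite coprimezE coprime_sym prime_coprime.
have vp : v (p : int)%:~R = 1 by case: vE.
(* The cases u = 0 and w = 0 are separate because v 0 is a junk value. *)
have [u0|u0] := eqVneq u 0.
  have : (p%:Z %| w * p)%Z by rewrite dvdz_mull.
  move: uw; rewrite u0 mul0r add0r => ->; rewrite dvdzE /= dvdn1 => /eqP p1.
  by rewrite p1 in p_prime.
have vub := @val_intM u b u0 b0; have vu := @val_int_ge0 u u0.
have [w0|w0] := eqVneq w 0.
  by move: vub; rewrite -[u * b](addr0) -(mul0r p%:Z) -w0 uw val_int1; lra.
have := @val_intD (u * b) (w * p) _ _ _.
rewrite uw !mulf_neq0 // => /(_ isT isT isT); rewrite vub val_intM // vp val_int1.
by have := @val_int_ge0 w w0; rewrite ge_min => ? /orP[]; lra.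
Qed.

(** The valuations add up to m > 0 and their minimum is at most v (- b) <= 0. *)
Lemma val_ordinary_roots (b : int) (m : nat) (x y : R[i]) :
  prime p -> (0 < m)%N -> ~~ (p %| b)%Z ->
  x + y = - b%:~R -> x * y = (p ^ m)%N%:R -> (0 < v x) (+) (0 < v y).
Proof.
move=> p_prime m_gt0 pb xDy xMy; have p_gt0 := prime_gt0 p_prime.
have b0 : b != 0 by apply: contraNneq pb => ->; rewrite dvdz0.
have xy0 : x * y != 0 by rewrite xMy pnatr_eq0 -lt0n expn_gt0 p_gt0.
have [x0 y0] : x != 0 /\ y != 0 by move: xy0; rewrite mulf_eq0 negb_or => /andP.
have Kx : x != 0 /\ alg_over (eps E) x.
  split=> //; apply: (@alg_over_quadratic b (p ^ m)%N).
  by rewrite -[_%:~R]opprK -xDy -[(_%N : int)%:~R]/(_%N%:R) -xMy; ring.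
have Ky : y != 0 /\ alg_over (eps E) y.
  split=> //; apply: (@alg_over_quadratic b (p ^ m)%N).
  by rewrite -[_%:~R]opprK -xDy -[(_%N : int)%:~R]/(_%N%:R) -xMy; ring.
have [_ _ vM vD] := vE.
have := vM _ _ Kx Ky; rewrite xMy val_pX // => vxy.
have := vD _ _ Kx Ky; rewrite xDy oppr_eq0 intr_eq0 b0 => /(_ isT).
have vb : v (- b%:~R) <= 0.
  by rewrite -mulrNz; apply: val_int_coprime => //; rewrite dvdzE abszN.
have m0 : (0 : rat) < m%:R by rewrite ltr0n.
clear - vxy vb m0; rewrite ge_min => vxy_min.
case: ltP => x_gt0 /=; case: ltP => y_gt0 //=; exfalso.
  by case/orP: vxy_min => ?; lra.
by lra.
Qed.

End Valuation.

(** * Homomorphisms from Q[F] to the complex numbers *)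

Section RationalSubalgebra.
Variables (R : realType) (A : 'M[rat]_2).

Lemma mul_lin_mx2 (x y x' y' : rat) :
  (x%:M + y *: A) * (x'%:M + y' *: A) =
  (x * x' - y * y' * \det A)%:M + (x * y' + y * x' + y * y' * \tr A) *: A.
Proof.
apply: eq_mx2; rewrite [(_ * _ : 'M_2) _ _]mulmx2E det2 tr_mx2 !mxE /=; ring.
Qed.

(** Cayley-Hamilton reduces every polynomial in [A] to degree at most 1. *)
Lemma in_QFP (X : 'M[rat]_2) :
  in_QF A X <-> exists x y : rat, X = x%:M + y *: A.
Proof.
split=> [[P ->]|[x [y ->]]]; last first.
  exists (x%:P + y%:P * 'X).
  rewrite rmorphD rmorphM /= !horner_mx_C horner_mx_X.
  by rewrite -[_ * A]/(_ *m A) mul_scalar_mx.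
elim/poly_ind: P => [|P c [x [y IHP]]].
  by exists 0, 0; rewrite rmorph0 scale0r addr0 raddf0.
exists (c - y * \det A), (x + y * \tr A).
have -> : horner_mx A (P * 'X + c%:P) = horner_mx A P * A + c%:M.
  by rewrite rmorphD rmorphM /= horner_mx_C horner_mx_X.
have := mul_lin_mx2 x y 0 1; rewrite raddf0 add0r scale1r -IHP => ->.
rewrite addrAC -raddfD /= !mulr0 !mulr1 addr0 add0r; congr (_ + _).
by rewrite addrC.
Qed.

Lemma in_QF_lin (x y : rat) : in_QF A (x%:M + y *: A).
Proof. by apply/in_QFP; exists x, y. Qed.

Lemma in_QF_scalar (x : rat) : in_QF A x%:M.
Proof. by apply/in_QFP; exists x, 0; rewrite scale0r addr0. Qed.

Lemma in_QF_scale (y : rat) : in_QF A (y *: A).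
Proof. by apply/in_QFP; exists 0, y; rewrite raddf0 add0r. Qed.

Lemma in_QF_gen : in_QF A A.
Proof. by rewrite -[X in in_QF _ X]scale1r; apply: in_QF_scale. Qed.

(** On scalars phi is a ring morphism from Q to C, and there is only one. *)
Lemma QF_hom_scalar (phi : 'M[rat]_2 -> R[i]) (x : rat) :
  QF_hom A phi -> phi x%:M = ratr x.
Proof.
case=> phi1 phiD phiM; pose g (x : rat) := phi x%:M.
have gD : {morph g : x y / x + y}.
  by move=> a b; rewrite /g raddfD; apply: phiD; apply: in_QF_scalar.
have gM : {morph g : x y / x * y}.
  by move=> a b; rewrite /g scalar_mxM; apply: phiM; apply: in_QF_scalar.
have g0 : g 0 = 0 by apply: (addrI (g 0)); rewrite -gD !addr0.
have gN a : g (- a) = - g a.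
  by apply/eqP; rewrite -addr_eq0 -gD addNr g0.
have gB : zmod_morphism g by move=> a b; rewrite gD gN.
have g1 : monoid_morphism g by [].
pose G : {rmorphism rat -> R[i]} :=
  HB.pack g (GRing.isZmodMorphism.Build _ _ g gB)
            (GRing.isMonoidMorphism.Build _ _ g g1).
by rewrite -(fmorph_eq_rat G).
Qed.

Lemma QF_hom_lin (phi : 'M[rat]_2 -> R[i]) (x y : rat) :
  QF_hom A phi -> phi (x%:M + y *: A) = ratr x + ratr y * phi A.
Proof.
move=> phiP; case: (phiP) => _ phiD phiM.
rewrite phiD; [|exact: in_QF_scalar|exact: in_QF_scale].
rewrite (QF_hom_scalar _ phiP) -mul_scalar_mx phiM ?(QF_hom_scalar _ phiP) //.
  exact: in_QF_scalar.
exact: in_QF_gen.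
Qed.

Lemma QF_hom_root (phi : 'M[rat]_2 -> R[i]) : QF_hom A phi ->
  (phi A) ^+ 2 - ratr (\tr A) * phi A + ratr (\det A) = 0.
Proof.
move=> phiP; case: (phiP) => _ _ /(_ _ _ in_QF_gen in_QF_gen).
rewrite [A * A]cayley_hamilton2 addrC -[- _%:M]raddfN (QF_hom_lin _ _ phiP).
by rewrite rmorphN expr2 => <-; ring.
Qed.

(** The coefficients of X = x + y A are read off its first row: y = X01 / A01 and x = X00 - y A00.
    Off Q[A] the value is arbitrary. *)
Definition QF_eval (z : R[i]) (X : 'M[rat]_2) : R[i] :=
  ratr (X 0 0) + ratr (X 0 1 / A 0 1) * (z - ratr (A 0 0)).

Lemma QF_eval_lin z x y : A 0 1 != 0 ->
  QF_eval z (x%:M + y *: A) = ratr x + ratr y * z.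
Proof.
move=> A01; rewrite /QF_eval !mxE /= mulr1n mulr0n add0r mulfK //.
by rewrite rmorphD rmorphM /=; ring.
Qed.

Lemma QF_evalP (z : R[i]) : A 0 1 != 0 ->
  z ^+ 2 - ratr (\tr A) * z + ratr (\det A) = 0 ->
  QF_hom A (QF_eval z) /\ QF_eval z A = z.
Proof.
move=> A01 z_root; have lin := QF_eval_lin z _ _ A01.
have evA : QF_eval z A = z.
  by have := lin 0 1; rewrite raddf0 scale1r add0r rmorph0 rmorph1 mul1r add0r.
split=> //; split.
- have := lin 1 0; rewrite scale0r addr0 => ->.
  by rewrite rmorph1 rmorph0 mul0r addr0.
- move=> _ _ /in_QFP[x [y ->]] /in_QFP[x' [y' ->]].
  rewrite addrACA -raddfD -scalerDl !lin !rmorphD /=; ring.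
- move=> _ _ /in_QFP[x [y ->]] /in_QFP[x' [y' ->]].
  rewrite mul_lin_mx2.
  rewrite !lin !(rmorphD, rmorphM, rmorphB, rmorphN) /=.
  apply/eqP; rewrite -subr_eq0 -oppr_eq0 -(mulr0 (ratr y * ratr y')) -z_root.
  by apply/eqP; ring.
Qed.

End RationalSubalgebra.

(** * The CM type and the purely imaginary elements when Q[A] is imaginary quadratic *)

Section ImaginaryQuadratic.
Variables (R : realType) (B : int) (q : nat).
Hypothesis disc_lt0 : B ^+ 2 < 4 * q%:Z.
Implicit Types z om : R[i].

Lemma disc_lt0_num (F : numDomainType) : (B%:~R : F) ^+ 2 < 4 * q%:R.
Proof.
have : ((B ^+ 2)%:~R : F) < (4 * q%:Z)%:~R by rewrite ltr_int.
by rewrite rmorphXn rmorphM.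
Qed.

Lemma ratr_complex (x : rat) : ratr x = (ratr x : R)%:C%C :> R[i].
Proof. exact: (esym (fmorph_rat (real_complex R) x)). Qed.

Lemma conj_ratr (x : rat) : (ratr x)^* = ratr x :> R[i].
Proof. exact: fmorph_rat. Qed.

Lemma int_complex (n : int) : n%:~R = (n%:~R : R)%:C%C :> R[i].
Proof. by rewrite -(rmorph_int (real_complex R)). Qed.

(** A real root would make (2 x + B)^2 equal to the negative discriminant. Otherwise the imaginary
    part of the equation gives 2 Re z = - B, so the conjugate is the other root. *)
Lemma quadratic_root_conj z : z ^+ 2 + B%:~R * z + q%:R = 0 ->
  [/\ z + z^* = - B%:~R, z * z^* = q%:R & complex.Im z != 0].
Proof.
have dR := disc_lt0_num R.
rewrite -[q%:R]/((q%:Z)%:~R) !int_complex; case: z => x y.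
move: dR; rewrite -[q%:R]/((q%:Z)%:~R); move: (B%:~R : R) (q%:~R : R) => b c dR.
move=> /eqP; rewrite expr2 eq_complex /= => /andP[/eqP re /eqP im].
have y0 : y != 0.
  apply/eqP => y0; rewrite y0 in re; have := sqr_ge0 (2 * x + b).
  by nra.
have xb : 2 * x = - b by apply: (mulIf y0); lra.
split=> //; apply/eqP; rewrite eq_complex /=; apply/andP; split; apply/eqP; try lra.
by nra.
Qed.

Lemma quadratic_rootP om z : om ^+ 2 + B%:~R * om + q%:R = 0 ->
  z ^+ 2 + B%:~R * z + q%:R = 0 <-> z = om \/ z = om^*.
Proof.
move=> /quadratic_root_conj[sumE prodE _].
have -> : z ^+ 2 + B%:~R * z + q%:R = (z - om) * (z - om^*).
  by rewrite -prodE -[B%:~R]opprK -sumE; ring.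
split=> [/eqP|[]->]; last 2 first.
- by rewrite subrr mul0r.
- by rewrite subrr mulr0.
by rewrite mulf_eq0 !subr_eq0 => /orP[]/eqP->; [left|right].
Qed.

(** The negative number (tr A)^2 - 4 det A equals (A00 - A11)^2 + 4 A01 A10. In particular A01 is
    nonzero, as [QF_evalP] requires. *)
Lemma off_diag_lt0 (F : realFieldType) (A : 'M[F]_2) :
  \tr A = - B%:~R -> \det A = q%:R -> A 0 1 * A 1 0 < 0.
Proof.
rewrite tr_mx2 det2 => trA detA.
have := disc_lt0_num F.
rewrite -detA -[B%:~R]opprK -trA => ?; have := sqr_ge0 (A 0 0 - A 1 1).
by nra.
Qed.

Variables (v : R[i] -> rat) (om : R[i]).
Hypothesis om_root : om ^+ 2 + B%:~R * om + q%:R = 0.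
Hypotheses (v_om : 0 < v om) (v_om_conj : ~~ (0 < v om^*)).

Section Iota.
Variable A : 'M[rat]_2.
Hypotheses (trA : \tr A = - B%:~R) (detA : \det A = q%:R).

Lemma QF_hom_quadratic (phi : 'M[rat]_2 -> R[i]) : QF_hom A phi ->
  (phi A) ^+ 2 + B%:~R * phi A + q%:R = 0.
Proof.
move=> /QF_hom_root; rewrite trA detA rmorphN rmorph_int rmorph_nat => <-; ring.
Qed.

Lemma QF_hom_quadraticP z : z ^+ 2 + B%:~R * z + q%:R = 0 ->
  exists2 phi, QF_hom A phi & phi A = z.
Proof.
move=> z_root; have A01 : A 0 1 != 0.
  by have := off_diag_lt0 trA detA; apply: contraTneq => ->; rewrite mul0r ltxx.
have [|phiP phiA] := @QF_evalP _ _ z A01; last by exists (QF_eval A z).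
by rewrite trA detA rmorphN rmorph_int rmorph_nat -z_root; ring.
Qed.

Lemma CM_typeP (phi : 'M[rat]_2 -> R[i]) :
  CM_type v A phi <-> QF_hom A phi /\ phi A = om.
Proof.
split=> [[phiP v_phi]|[phiP phiA]]; last by split; rewrite ?phiA.
split=> //; move: v_phi.
have /(quadratic_rootP _ om_root)[->|->] := QF_hom_quadratic phiP => //.
by rewrite (negPf v_om_conj).
Qed.

(* The purely imaginary elements of Q[A] are the rational multiples of *)
(* A - (tr A / 2) = A + B / 2.                                         *)
Definition imag_elt (y : rat) : 'M[rat]_2 := (y * B%:~R / 2)%:M + y *: A.

Lemma Im_QF_hom (phi : 'M[rat]_2 -> R[i]) x y : QF_hom A phi ->
  complex.Im (phi (x%:M + y *: A)) = ratr y * complex.Im (phi A).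
Proof.
move=> /QF_hom_lin->; rewrite !ratr_complex; case: (phi A) => a b /=.
by rewrite mul0r addr0 add0r.
Qed.

(** The right side is the trace of x + y A in Q, so a purely imaginary element has x = y B / 2. *)
Lemma conj_QF_hom (phi : 'M[rat]_2 -> R[i]) x y : QF_hom A phi ->
  (phi (x%:M + y *: A))^* + phi (x%:M + y *: A) = ratr (2 * x - y * B%:~R).
Proof.
move=> phiP; have [sumE _ _] := quadratic_root_conj (QF_hom_quadratic phiP).
rewrite (QF_hom_lin _ _ phiP) rmorphD (rmorphM _ (ratr y)) /= !conj_ratr.
rewrite rmorphB !rmorphM /= rmorph_int rmorph_nat -[B%:~R]opprK -sumE; ring.
Qed.

(** The conjugation condition says that the trace vanishes, which fixes x; since phi A = om
    throughout the CM type, phi iota is then i times y Im om. *)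
Lemma imag_eltP (iota : 'M[rat]_2) :
  QF_conj R A iota (- iota) /\
    (forall phi, CM_type v A phi -> pos_imaginary (phi iota)) <->
  exists2 y : rat, iota = imag_elt y & 0 < ratr y * complex.Im om.
Proof.
have ratr_inj : injective (ratr : rat -> R[i]) by apply: fmorph_inj.
split=> [[[/in_QFP[x [y ->]] _ conjP] posP]|[y -> y_gt0]].
- have [phi phiP phiA] := QF_hom_quadraticP om_root.
  have := conjP phi phiP.
  have -> : - (x%:M + y *: A) = (- x)%:M + (- y) *: A.
    by rewrite opprD raddfN scaleNr.
  rewrite (QF_hom_lin (- x) (- y) phiP) (QF_hom_lin x y phiP) => conjE.
  have := conj_QF_hom x y phiP; rewrite (QF_hom_lin x y phiP) -conjE !rmorphN.
  have -> : - ratr x + - ratr y * phi A + (ratr x + ratr y * phi A) = ratr 0.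
    by rewrite rmorph0; ring.
  move=> /ratr_inj xy.
  exists y; first by rewrite /imag_elt; congr (_%:M + _); lra.
  have [|w w_gt0 phiE] := posP phi; first by apply/CM_typeP.
  by rewrite -phiA -(@Im_QF_hom _ x) // phiE.
- have oppE : - imag_elt y = imag_elt (- y).
    by rewrite /imag_elt opprD scaleNr !mulNr raddfN.
  split; last first.
    move=> phi /CM_typeP[phiP phiA]; exists (ratr y * complex.Im om) => //.
    have im := Im_QF_hom (y * B%:~R / 2) y phiP.
    have := conj_QF_hom (y * B%:~R / 2) y phiP; rewrite -/(imag_elt y) in im *.
    have -> : 2 * (y * B%:~R / 2) - y * B%:~R = 0 by lra.
    rewrite rmorph0 -phiA -im; case: (phi _) => a b /= /eqP.
    by rewrite eq_complex /= => /andP[/eqP ? _]; congr Complex; lra.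
  split; rewrite ?oppE; try exact: in_QF_lin.
  move=> phi phiP; rewrite -[RHS]subr0; apply/eqP; rewrite eq_sym subr_eq.
  apply/eqP/(addrI (phi (imag_elt y))).
  rewrite addrC conj_QF_hom // (QF_hom_lin _ _ phiP) (QF_hom_lin _ _ phiP).
  have -> : 2 * (y * B%:~R / 2) - y * B%:~R = 0 by lra.
  rewrite !(rmorphM, rmorphN) /= rmorph0; ring.
Qed.

End Iota.

End ImaginaryQuadratic.

(** * Symplectic bases and isomorphisms *)

Lemma additive_of_morph (U V : zmodType) (f : U -> V) :
  {morph f : x y / x + y} -> {g : {additive U -> V} | g =1 f}.
Proof.
move=> fD; have fB : zmod_morphism f.
  have f0 : f 0 = 0 by apply: (addrI (f 0)); rewrite -fD !addr0.
  have fN x : f (- x) = - f x by apply/eqP; rewrite -addr_eq0 -fD addNr f0.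
  by move=> x y; rewrite fD fN.
by exists (HB.pack f (GRing.isZmodMorphism.Build _ _ f fB) : {additive U -> V}).
Qed.

Lemma additive_inverse (U V : zmodType) (f : {additive U -> V}) :
  bijective f -> exists g : {additive V -> U}, cancel f g /\ cancel g f.
Proof.
case=> h fK hK; have [|g gE] := @additive_of_morph _ _ h.
  by move=> x y; apply: (can_inj fK); rewrite raddfD !hK.
by exists g; split=> x; rewrite gE.
Qed.

Lemma additive_cV2 (V : zmodType) (f : {additive 'cV[int]_2 -> V}) x :
  f x = f (delta_mx 0 0) *~ x 0 0 + f (delta_mx 1 0) *~ x 1 0.
Proof.
rewrite -!raddfMz -raddfD; congr (f _); apply: eq_cV2.
  by rewrite !mxE -!scaler_int !mxE /= !intz; ring.
by rewrite !mxE -!scaler_int !mxE /= !intz; ring.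
Qed.

Lemma mulmx_delta (R : pzSemiRingType) (N : 'M[R]_2) i j :
  (N *m delta_mx j 0 : 'cV_2) i 0 = N i j.
Proof. by rewrite -colE mxE. Qed.

Lemma mulmx_cV2_inj (R : pzSemiRingType) (N N' : 'M[R]_2) :
  (forall x : 'cV_2, N *m x = N' *m x) -> N = N'.
Proof. by move=> NN'; apply/matrixP => i j; rewrite -!mulmx_delta NN'. Qed.

Lemma additive_mx2 (f : {additive 'cV[int]_2 -> 'cV[int]_2}) :
  exists N : 'M[int]_2, forall x, f x = N *m x.
Proof.
exists (\matrix_(i, j) f (delta_mx j 0) i 0) => x.
by rewrite additive_cV2; apply/matrixP => i j; rewrite ord1 mulmx2E !mxE
  -!scaler_int !mxE !intz mulrC [X in _ + X]mulrC.
Qed.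

Lemma sympE (x y : 'cV[int]_2) :
  (x^T *m symp_mx *m y) 0 0 = x 0 0 * y 1 0 - x 1 0 * y 0 0.
Proof. by rewrite !mxE big_ord2 !mxE !big_ord2 !mxE /=; ring. Qed.

Lemma symp_mulmx (N : 'M[int]_2) (x y : 'cV[int]_2) :
  ((N *m x)^T *m symp_mx *m (N *m y)) 0 0
  = \det N * (x^T *m symp_mx *m y) 0 0.
Proof. by rewrite !sympE !mulmx2E det2; ring. Qed.

Lemma symp_preserving_det (N : 'M[int]_2) :
  (forall x y : 'cV_2, ((N *m x)^T *m symp_mx *m (N *m y)) 0 0
     = (x^T *m symp_mx *m y) 0 0) -> \det N = 1.
Proof.
move=> /(_ (delta_mx 0 0) (delta_mx 1 0)); rewrite symp_mulmx sympE !mxE /=.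
by rewrite mulr0 mulr1 subr0 mulr1.
Qed.

(** A stable line would be spanned by an eigenvector; the zero space and the plane complement each
    other. *)
Lemma semisimple_no_eigenvalue (A : 'M[rat]_2) :
  (forall a : rat, ~~ root (char_poly A) a) -> semisimple_mx A.
Proof.
move=> noroot U stabU; have := rank_leq_row U.
case rU : (\rank U) => [|[|[|//]]] _.
- move/eqP: rU; rewrite mxrank_eq0 => /eqP->; exists 1%:M.
  by split; rewrite ?submx1 // ?cap0mx ?sub0mx // !adds0mx submx_refl.
- have u0 : nz_row U != 0 by rewrite nz_row_eq0 -mxrank_eq0 rU.
  have uU : (U <= nz_row U)%MS.
    by rewrite -(mxrank_leqif_sup (nz_row_sub U)) rU rank_rV u0.
  have : (nz_row U *m A^T <= nz_row U)%MS.
    by apply: submx_trans uU; apply: submx_trans stabU; apply: submxMr (nz_row_sub U).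
  case/sub_rVP=> a uA; case/negP: (noroot a).
  (* The stable line belongs to the transpose, which has the same characteristic polynomial. *)
  have -> : char_poly A = char_poly A^T.
    by rewrite !char_poly2 mxtrace_tr det_tr.
  by rewrite -eigenvalue_root_char; apply/eigenvalueP; exists (nz_row U).
- exists 0; split; rewrite ?mul0mx ?sub0mx ?capmx0 ?sub0mx //.
  by rewrite !addsmx0 submx1 sub1mx /row_full rU.
Qed.

Lemma coord_mxP (T : zmodType) (c : {additive T -> 'cV[int]_2})
    (d : 'cV[int]_2 -> T) (f : {additive T -> T}) :
  cancel c d -> cancel d c -> forall x, coord_mx c d f *m c x = c (f x).
Proof.
move=> cK dK x; have [|d' d'E] := @additive_of_morph _ _ d.
  by move=> y z; apply: (can_inj cK); rewrite raddfD !dK.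
have [|h hE] := @additive_of_morph _ _ (fun y => c (f (d' y))).
  by move=> y z; rewrite !raddfD.
have -> : c (f x) = h (c x) by rewrite hE d'E cK.
rewrite [h _]additive_cV2; apply/matrixP => i j; rewrite ord1 mulmx2E !mxE.
by rewrite -!scaler_int !mxE !intz !hE !d'E mulrC [X in _ + X]mulrC.
Qed.

Lemma coord_mx_id (A : 'M[int]_2) : coord_mx id id (mulmx A) = A.
Proof. by apply/matrixP => i j; rewrite mxE mulmx_delta. Qed.

(** * Modules in a symplectic basis where the real structure is exactly [tau] *)

Section Framed.
Variables (R : realType) (p q : nat) (K : padic_closure p) (v : R[i] -> rat).

Definition framed (tau A : 'M[int]_2) (M : real_ppdm q K v) : Prop :=
  exists g : {additive 'cV[int]_2 -> M},
    [/\ bijective g,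
        forall x y, rlam (g x) (g y) = (x^T *m symp_mx *m y) 0 0,
        forall x, reta (g x) = g (tau *m x)
      & forall x, dmF M (g x) = g (A *m x)].

Lemma framed_corresponds tau A M : framed tau A M -> corresponds_to tau M.
Proof.
case=> g [g_bij lamE etaE _]; exists g, tau, 1%:M.
by split=> //; [rewrite det1 | rewrite invmx1 mul1mx mulmx1].
Qed.

(** Composing the basis with [S] turns [eta] into [tau] itself and keeps the form because det S =
    1. *)
Lemma corresponds_framed tau M : corresponds_to tau M ->
  exists A, framed tau A M.
Proof.
case=> g [N [S [g_bij lamE etaE detS NE]]].
have S_unit : S \in unitmx by rewrite unitmxE detS unitr1.
have [|g' g'E] := @additive_of_morph _ _ (fun x => g (S *m x)).
  by move=> x y; rewrite mulmxDr raddfD.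
have g'_bij : bijective g'.
  have [h [gK hK]] := additive_inverse g_bij.
  exists (fun x => invmx S *m h x) => x; rewrite g'E ?gK ?mulKmx //.
  by rewrite mulKVmx.
have [h [g'K hK]] := additive_inverse g'_bij.
have [|f fE] := @additive_of_morph _ _ (fun x => h (dmF M (g' x))).
  by move=> x y; rewrite !raddfD.
have [A AE] := additive_mx2 f; exists A, g'; split=> //.
- by move=> x y; rewrite !g'E lamE symp_mulmx detS mul1r.
- by move=> x; rewrite !g'E etaE NE !mulmxA mulmxKV.
- by move=> x; rewrite -AE fE hK.
Qed.

Lemma framed_isom tau A M N : framed tau A M -> framed tau A N -> dm_isom M N.
Proof.
case=> g [g_bij lamE etaE FE] [g' [g'_bij lamE' etaE' FE']].
have [h [gK hK]] := additive_inverse g_bij.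
have [|f fE] := @additive_of_morph _ _ (fun x => g' (h x)).
  by move=> x y; rewrite !raddfD.
have fg x : f (g x) = g' x by rewrite fE gK.
exists f; split.
- have [h' [g'K h'K]] := additive_inverse g'_bij.
  by exists (fun x => g (h' x)) => x; rewrite ?fg ?fE ?g'K ?hK.
- by move=> x; rewrite -[x]hK FE !fg FE'.
- by move=> x; rewrite -[x]hK etaE !fg etaE'.
- by move=> x y; rewrite -[x]hK -[y]hK !fg lamE lamE'.
Qed.

(** Nonvanishing of n is the form in which [isom_framed] uses it, to cancel n from n A = n A'. *)
Definition scalar_centralizer (tau : 'M[int]_2) : Prop :=
  forall N : 'M[int]_2, N *m tau = tau *m N -> \det N = 1 ->
  exists2 n : int, n != 0 & N = n%:M.

(** Read in the two frames, an isomorphism is a matrix P of determinant 1 commuting with [tau],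
    hence a scalar, and P A = A' P. This rigidity is why matrices are counted and not orbits. *)
Lemma isom_framed tau A A' M N : scalar_centralizer tau ->
  framed tau A M -> framed tau A' N -> dm_isom M N -> A = A'.
Proof.
move=> centP [g [g_bij lamE etaE FE]] [g' [g'_bij lamE' etaE' FE']].
case=> f [f_bij fF feta flam].
have [h' [g'K h'K]] := additive_inverse g'_bij.
have [|k kE] := @additive_of_morph _ _ (fun x => h' (f (g x))).
  by move=> x y; rewrite !raddfD.
have [P PE] := additive_mx2 k.
have gP x : g' (P *m x) = f (g x) by rewrite -PE kE h'K.
have g'_inj := can_inj g'K.
have Ptau : P *m tau = tau *m P.
  apply: mulmx_cV2_inj => x; apply: g'_inj.
  by rewrite -mulmxA gP -etaE feta -gP etaE' mulmxA.
have PA : P *m A = A' *m P.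
  apply: mulmx_cV2_inj => x; apply: g'_inj.
  by rewrite -mulmxA gP -FE fF -gP FE' mulmxA.
have detP : \det P = 1.
  by apply: symp_preserving_det => x y; rewrite -lamE' !gP flam lamE.
have [n n0 PEn] := centP P Ptau detP.
move: PA; rewrite PEn mul_scalar_mx mul_mx_scalar => /matrixP nA.
apply/matrixP => i j; have := nA i j; rewrite !mxE; exact: mulfI.
Qed.

End Framed.

(** * Positivity and the standard modules *)

(** [adj2 A] is the matrix of V, since F V = q = det A; the first condition is thus the relation
    between [eta], F and V. *)
Definition real_frobenius (B : int) (q : nat) (s : int) (tau A : 'M[int]_2) :=
  [/\ tau *m A *m tau = adj2 A, \tr A = - B, \det A = q%:Z & 0 < s * A 1 0].

Lemma symp_form_gram (x y : 'cV[rat]_2) :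
  \sum_i \sum_j x i 0 *
    (((delta_mx i 0 : 'cV[int]_2)^T *m symp_mx *m (delta_mx j 0 : 'cV_2)) 0 0)%:~R
    * y j 0 = x 0 0 * y 1 0 - x 1 0 * y 0 0.
Proof.
rewrite !big_ord2 !sympE !mxE /=.
by rewrite !(mulr0, mul0r, mulr1, subr0, sub0r, mulr0z, mulr1z, mulrNz); ring.
Qed.

Section Modules.
Variables (R : realType) (p m : nat).
Let q := (p ^ m)%N.
Variables (K : padic_closure p) (v : R[i] -> rat) (B s : int) (om : R[i]).
Hypotheses (p_prime : prime p) (m_gt0 : (0 < m)%N) (B_ndvd : ~~ (p %| B)%Z).
Hypothesis disc_lt0 : B ^+ 2 < 4 * q%:Z.
Hypothesis om_root : om ^+ 2 + B%:~R * om + q%:R = 0.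
Hypotheses (v_om : 0 < v om) (v_om_conj : ~~ (0 < v om^*)).
Hypotheses (s2 : s ^+ 2 = 1) (s_om : 0 < s%:~R * complex.Im om).

Let q_gt0 : (0 < q)%N. Proof. by rewrite expn_gt0 prime_gt0. Qed.

(** For the direct implication: om and its conjugate are distinct roots of the characteristic
    polynomial, so subtracting the two equations yields the trace, and then the determinant. *)
Lemma has_eigenvaluesP (M : deligne_module R q K) :
  has_eigenvalues M om om^* <-> \tr (mxF M) = - B /\ \det (mxF M) = q.
Proof.
have [sumE prodE om_im] := quadratic_root_conj disc_lt0 om_root.
rewrite /has_eigenvalues; move: (mxF M) => A.
have eigE z : eigenvalue (map_mx intr A : 'M[R[i]]_2) z =
    (z ^+ 2 - (\tr A)%:~R * z + (\det A)%:~R == 0).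
  by rewrite eigenvalue_root_char root_char_poly2 trace_map_mx det_map_mx.
split=> [eigA|[trA detA] z]; last first.
  rewrite eigE trA detA mulrNz mulNr opprK.
  split=> [/eqP|] /(quadratic_rootP disc_lt0 _ om_root)// zE.
  exact/eqP.
have := eigE om; have -> : eigenvalue (map_mx intr A : 'M[R[i]]_2) om.
  by apply/eigA; left.
have := eigE om^*; have -> : eigenvalue (map_mx intr A : 'M[R[i]]_2) om^*.
  by apply/eigA; right.
move=> /esym/eqP eq1 /esym/eqP eq2.
have ne : om - om^* != 0.
  apply: contraNneq om_im => /eqP; rewrite subr_eq0; case: (om) => a b /=.
  by rewrite eq_complex /= => /andP[_ /eqP bb]; apply/eqP; lra.
have trA : (\tr A)%:~R = om + om^* :> R[i].
  apply: (mulfI ne); apply/eqP; rewrite -subr_eq0; apply/eqP.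
  by rewrite -[RHS](subrr 0) -{1}eq1 -eq2; ring.
have detA : (\det A)%:~R = om * om^* :> R[i].
  apply/eqP; rewrite -subr_eq0; apply/eqP; rewrite -[RHS]eq1 trA; ring.
split; apply: (@intr_inj R[i]); first by rewrite trA sumE mulrNz.
by rewrite detA prodE.
Qed.

(** The basis [g] and the coordinates [toZ2] of the record differ by an invertible P, which
    conjugates A into [mxF M]. *)
Lemma framed_tr_det (tau A : 'M[int]_2) (M : real_ppdm q K v) :
  framed tau A M -> \tr A = \tr (mxF M) /\ \det A = \det (mxF M).
Proof.
case=> g [g_bij _ _ FE]; have [h [gK hK]] := additive_inverse g_bij.
have [|d dE] := @additive_of_morph _ _ (@ofZ2 _ _ _ _ M).
  by move=> x y; apply: (can_inj (@toZ2K _ _ _ _ M)); rewrite raddfD !ofZ2K.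
have [P PE] := additive_mx2 (@toZ2 _ _ _ _ M \o g).
have [Q QE] := additive_mx2 (h \o d).
have PQ : P *m Q = 1%:M.
  apply: mulmx_cV2_inj => x.
  by rewrite -mulmxA -QE -PE mul1mx /= hK dE ofZ2K.
have PA : P *m A = mxF M *m P.
  apply: mulmx_cV2_inj => x; rewrite -!mulmxA -!PE /= coord_mxP ?FE //.
    exact: toZ2K.
  exact: ofZ2K.
have -> : mxF M = P *m A *m Q by rewrite PA -mulmxA PQ mulmx1.
split.
  by rewrite -mulmxA mxtrace_mulC -mulmxA (mulmx1C PQ) mulmx1.
by rewrite !det_mulmx mulrAC -det_mulmx PQ det1 mul1r.
Qed.

Lemma framed_dmV (tau A : 'M[int]_2) (M : real_ppdm q K v) (g : 'cV_2 -> M) :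
  bijective g -> {morph g : x y / x + y} ->
  (forall x, dmF M (g x) = g (A *m x)) -> \det A = q ->
  forall x, dmV M (g x) = g (adj2 A *m x).
Proof.
move=> [h gK hK] gD FE detA x; have [g' g'E] := additive_of_morph gD.
rewrite -[dmV M (g x)]hK; congr g.
have : A *m h (dmV M (g x)) = q%:Z *: x.
  apply: (can_inj gK); rewrite -FE hK dmFV -!g'E -raddfMn; congr (g' _).
  by rewrite -scaler_nat natz.
move/(congr1 (mulmx (adj2 A))); rewrite mulmxA mul_adj2l detA mul_scalar_mx.
rewrite -scalemxAr => /matrixP eqx; apply/matrixP => i j.
have := eqx i j; rewrite [LHS]mxE [RHS]mxE; apply: mulfI.
by rewrite -lt0n.
Qed.

(** Positivity is stated on Q^2 through the arbitrary coordinates [toZ2], while a frame computes on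
    T; this passes between the two. *)
Lemma formQ_toZ2 (M : real_ppdm q K v) (x y : M) :
  formQ (@rlam _ _ _ _ _ M) (map_mx intr (toZ2 M x)) (map_mx intr (toZ2 M y))
  = (rlam x y)%:~R.
Proof.
have [|d dE] := @additive_of_morph _ _ (@ofZ2 _ _ _ _ M).
  by move=> z t; apply: (can_inj (@toZ2K _ _ _ _ M)); rewrite raddfD !ofZ2K.
rewrite -{2}[x]toZ2K -{2}[y]toZ2K -!dE; move: (toZ2 M x) (toZ2 M y) => X Y.
have [|l lE] := @additive_of_morph _ _ (fun z => rlam (d z) (d Y)).
  by move=> z t; rewrite raddfD; apply: (pol_addl (rlam_pol M)).
have r u : {r : {additive 'cV[int]_2 -> int} | r =1 fun z => rlam u (d z)}.
  apply: additive_of_morph.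
  by move=> z t; rewrite raddfD; apply: (pol_addr (rlam_pol M)).
have [r0 r0E] := r (d (delta_mx 0 0)); have [r1 r1E] := r (d (delta_mx 1 0)).
rewrite -lE [l X]additive_cV2 !lE -r0E -r1E [r0 Y]additive_cV2.
rewrite [r1 Y]additive_cV2 !r0E !r1E !dE /formQ !big_ord2 !mxE.
do 4!move: (rlam _ _) => ?; move: (X _ _) (X _ _) (Y _ _) (Y _ _) => *.
by rewrite !mulrzz !intrD !intrM; ring.
Qed.

Lemma formQ_linr (M : deligne_module R q K) (lam : M -> M -> int) x a b y z :
  formQ lam x (a *: y + b *: z) = a * formQ lam x y + b * formQ lam x z.
Proof. by rewrite /formQ !big_ord2 !mxE; ring. Qed.

(** Positivity is tested at one vector u = g e_0 with iota = s (F + B / 2), admissible because s Im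
    om > 0: the alternating form kills the scalar part and leaves s lam (u, F u) = s A10. *)
Lemma framed_pos (tau A : 'M[int]_2) (M : real_ppdm q K v) :
  framed tau A M -> \tr A = - B -> \det A = q -> 0 < s * A 1 0.
Proof.
move=> frA trA detA; have [trM detM] := framed_tr_det frA.
case: frA => g [g_bij lamE _ FE].
have trQ : \tr (mxFQ M) = - B%:~R.
  by rewrite trace_map_mx -trM trA rmorphN.
have detQ : \det (mxFQ M) = q%:R by rewrite det_map_mx -detM detA.
have [conjP posP] : QF_conj R (mxFQ M) (imag_elt B (mxFQ M) s%:~R)
      (- imag_elt B (mxFQ M) s%:~R) /\
    (forall phi, CM_type v (mxFQ M) phi ->
       pos_imaginary (phi (imag_elt B (mxFQ M) s%:~R))).
  apply/(imag_eltP disc_lt0 om_root v_om v_om_conj trQ detQ).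
  by exists s%:~R => //; rewrite ratr_int.
have [_ ] := pol_pos (rlam_pol M) conjP posP.
pose u := g (delta_mx 0 0).
move=> /(_ (map_mx intr (toZ2 M u))); rewrite /imag_elt mulmxDl mul_scalar_mx.
have -> : s%:~R *: mxFQ M *m map_mx intr (toZ2 M u)
    = s%:~R *: map_mx intr (toZ2 M (dmF M u)).
  rewrite -scalemxAl /mxFQ -map_mxM coord_mxP //.
    exact: toZ2K.
  exact: ofZ2K.
rewrite formQ_linr !formQ_toZ2 (pol_alt (rlam_pol M)) mulr0 add0r.
rewrite /u FE lamE sympE !mulmx_delta !mxE /= mul1r mul0r subr0 -intrM ltr0z.
(* [u] is nonzero because it pairs to 1 with the second basis vector. *)
apply; apply/eqP => u0; have : rlam u (g (delta_mx 1 0)) = 1.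
  by rewrite lamE sympE !mxE.
have -> : u = 0.
  have [d [dK Kd]] : exists d : {additive _ -> M},
      cancel (toZ2 M) d /\ cancel d (toZ2 M).
    apply: additive_inverse; exists (@ofZ2 _ _ _ _ M).
      exact: toZ2K.
    exact: ofZ2K.
  rewrite -[u]dK -(raddf0 d); congr (d _); apply/matrixP => i j.
  have := congr1 (fun X : 'cV_2 => X i j) u0; rewrite /u !mxE.
  by move/eqP; rewrite intr_eq0 => /eqP.
have lam0 : rlam (0 : M) (g (delta_mx 1 0)) = 0.
  by apply: (addrI (rlam (0 : M) (g (delta_mx 1 0))));
     rewrite -(pol_addl (rlam_pol M)) !addr0.
by rewrite lam0.
Qed.

Lemma corresponds_real_frobenius (tau : 'M[int]_2) (M : real_ppdm q K v) :
  has_eigenvalues M om om^* -> corresponds_to tau M ->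
  exists2 A, real_frobenius B q s tau A & framed tau A M.
Proof.
move=> /has_eigenvaluesP[trM detM] /corresponds_framed[A frA].
exists A => //; have [trA detA] := framed_tr_det frA; rewrite trM in trA.
rewrite detM in detA; split=> //; last exact: framed_pos frA trA detA.
case: frA => g [g_bij _ etaE FE].
have VE := framed_dmV tau g_bij (raddfD g) FE detA.
have [h [gK _]] := additive_inverse g_bij.
apply: mulmx_cV2_inj => x; apply: (can_inj gK).
by rewrite -VE -(real_FV (reta_real M)) etaE FE etaE !mulmxA.
Qed.

(** A rational eigenvalue a would give (2 a + B)^2 = B^2 - 4 q < 0. *)
Lemma quadratic_semisimple (A : 'M[int]_2) : \tr A = - B -> \det A = q ->
  semisimple_mx (map_mx intr A).
Proof.
move=> trA detA; apply: semisimple_no_eigenvalue => a.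
rewrite root_char_poly2 trace_map_mx det_map_mx trA detA.
apply/eqP; rewrite rmorphN mulNr opprK => a_root.
have := sqr_ge0 (2 * a + B%:~R).
have -> : (2 * a + B%:~R) ^+ 2 =
    4 * (a ^+ 2 + B%:~R * a + q%:R) + (B%:~R ^+ 2 - 4 * q%:R) by ring.
rewrite [a ^+ 2 + _ + _]a_root mulr0 add0r subr_ge0 leNgt.
by rewrite (disc_lt0_num disc_lt0).
Qed.

Lemma quadratic_weil (A : 'M[int]_2) : \tr A = - B -> \det A = q ->
  forall z : R[i], eigenvalue (map_mx intr A : 'M[R[i]]_2) z ->
  `|z| = sqrtC q%:R.
Proof.
move=> trA detA z; rewrite eigenvalue_root_char root_char_poly2.
rewrite trace_map_mx det_map_mx trA detA rmorphN mulNr opprK => /eqP z_root.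
by have [_ <- _] := quadratic_root_conj disc_lt0 z_root; rewrite normC_def.
Qed.

Lemma quadratic_ordinary (A : 'M[int]_2) : \tr A = - B -> \det A = q ->
  exists a b : Qp_bar K,
    [/\ map_poly intr (char_poly A) = ('X - a%:P) * ('X - b%:P),
        padic_unit a, ~ padic_unit b & padic_dvd q%:R b].
Proof.
move=> trA detA; have [a [b [fact ua nub qb]]] :=
  ordinary_quadratic K p_prime m_gt0 B_ndvd.
exists a, b; split=> //.
by rewrite map_char_poly char_poly2 trace_map_mx det_map_mx trA detA -fact
  rmorphN scaleNr opprK.
Qed.

Lemma quadratic_trace (A : 'M[int]_2) : \tr A = - B -> coprimez (\tr A) p.
Proof. by move->; rewrite coprimezE abszN coprime_sym prime_coprime. Qed.

(** * The module on the standard symplectic lattice defined by a real Frobenius matrix *)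

Definition lam_std (x y : 'cV[int]_2) : int := (x^T *m symp_mx *m y) 0 0.

Lemma lam_std_principal (f : {additive 'cV[int]_2 -> int}) :
  exists! x, forall y, lam_std x y = f y.
Proof.
pose x0 : 'cV[int]_2 :=
  \col_i (if i == 0 then f (delta_mx 1 0) else - f (delta_mx 0 0)).
exists x0; split=> [y|x xf].
  rewrite /lam_std sympE [f y]additive_cV2 !mulrzz !mxE /=.
  by move: (f _) (f _) (y _ _) (y _ _) => *; ring.
apply: eq_cV2; rewrite mxE /= -xf /lam_std sympE !mxE /=.
  by rewrite mulr1 mulr0 subr0.
by rewrite mulr1 mulr0 sub0r opprK.
Qed.

(** y and s both have the sign of Im om, and c has the sign of s. *)
Lemma sign_transfer (y : rat) (c : int) :
  0 < ratr y * complex.Im om -> 0 < s * c -> 0 < y * c%:~R.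
Proof.
move=> y_om sc; have ys : 0 < y * s%:~R.
  rewrite -(ltr0q R) rmorphM /= ratr_int.
  have im2 : 0 < complex.Im om ^+ 2.
    by rewrite exprn_even_gt0 //=; apply: contraTneq s_om => ->; rewrite mulr0 ltxx.
  rewrite -(pmulr_lgt0 _ im2) expr2 mulrACA.
  exact: mulr_gt0.
have : 0 < y * s%:~R * (s * c)%:~R by rewrite mulr_gt0 // ltr0z.
by rewrite -mulrA -intrM mulrA -expr2 s2 mul1r.
Qed.

(* For A = [[a, b], [c, d]] this is y (c x0^2 + (d - a) x0 x1 - b x1^2), of *)
(* discriminant y^2 (B^2 - 4 q) < 0, hence definite with the sign of y c.    *)
Lemma imag_form_pos (A : 'M[rat]_2) (y : rat) (x : 'cV[rat]_2) :
  \tr A = - B%:~R -> \det A = q%:R -> 0 < y * A 1 0 -> x != 0 ->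
  0 < x 0 0 * (imag_elt B A y *m x) 1 0 - x 1 0 * (imag_elt B A y *m x) 0 0.
Proof.
rewrite tr_mx2 det2 => trA detA yc x0.
rewrite !mulmx2E !mxE /= !(mulr1n, mulr0n).
have := disc_lt0_num disc_lt0 rat; rewrite -detA -[B%:~R]opprK -trA.
have x0' : x 0 0 != 0 \/ x 1 0 != 0.
  have [x00|] := eqVneq (x 0 0) 0; last by left.
  right; apply: contraNneq x0 => x10; apply/eqP/eq_cV2; by rewrite !mxE.
move: (A 0 0) (A 0 1) (A 1 0) (A 1 1) (x 0 0) (x 1 0) yc x0' {detA trA x0}.
move=> a b c d x0 x1 yc x01 disc.
(* Multiplication by 4 y c > 0 completes the square. *)
rewrite -(pmulr_rgt0 _ yc) -(@pmulr_rgt0 _ 4) //.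
have y2 : 0 < y ^+ 2.
  by rewrite exprn_even_gt0 //=; apply: contraTneq yc => ->; rewrite mul0r ltxx.
set lhs := (X in 0 < X).
have -> : lhs = y ^+ 2 * ((2 * c * x0 + (d - a) * x1) ^+ 2
   + (4 * (a * d - b * c) - (- (a + d)) ^+ 2) * x1 ^+ 2).
  by rewrite /lhs; field.
apply: mulr_gt0 => //; have [x10|x10] := eqVneq x1 0.
  case: x01; rewrite x10 ?eqxx // => x00.
  rewrite !mulr0 !addr0 exprn_even_gt0 //= mulf_neq0 // mulf_neq0 //.
  by apply: contraTneq yc => ->; rewrite mulr0 ltxx.
apply: ltr_wpDl; first exact: sqr_ge0.
by apply: mulr_gt0; rewrite ?subr_gt0 ?exprn_even_gt0.
Qed.

(** For the standard form, lam (x, N z) is symmetric in x and z exactly when N has trace zero, as y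
    (A + B / 2) does. *)
Lemma imag_form_sym (A : 'M[rat]_2) (y : rat) (x z : 'cV[rat]_2) :
  \tr A = - B%:~R ->
  x 0 0 * (imag_elt B A y *m z) 1 0 - x 1 0 * (imag_elt B A y *m z) 0 0 =
  z 0 0 * (imag_elt B A y *m x) 1 0 - z 1 0 * (imag_elt B A y *m x) 0 0.
Proof.
move=> trA; have BE : B%:~R = - (A 0 0 + A 1 1) by rewrite -tr_mx2 trA opprK.
by rewrite /imag_elt BE !mulmx2E !mxE /= !(mulr1n, mulr0n); field.
Qed.

(** T is Z^2 itself, with V = [adj2 A]. The module comes in a sigma type, so that the enumeration in
    [num_classes_real_frobenius] is a function. *)
Lemma real_frobenius_module (tau A : 'M[int]_2) :
  tau *m tau = 1%:M -> \det tau = -1 -> real_frobenius B q s tau A ->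
  {M : real_ppdm q K v | has_eigenvalues M om om^* & framed tau A M}.
Proof.
move=> tau2 det_tau [tauA trA detA sA].
have AV (x : 'cV[int]_2) : A *m (adj2 A *m x) = x *+ q.
  by rewrite mulmxA mul_adj2 detA mul_scalar_mx -scaler_nat natz.
have VA (x : 'cV[int]_2) : adj2 A *m (A *m x) = x *+ q.
  by rewrite mulmxA mul_adj2l detA mul_scalar_mx -scaler_nat natz.
have mxA : coord_mx idfun id (mulmx A) = A := coord_mx_id A.
have trA' : \tr (coord_mx idfun id (mulmx A)) = - B by rewrite mxA.
have detA' : \det (coord_mx idfun id (mulmx A)) = q by rewrite mxA.
have idK : cancel (idfun : 'cV[int]_2 -> 'cV[int]_2) id by [].
have idK' : cancel id (idfun : 'cV[int]_2 -> 'cV[int]_2) by [].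
pose M0 : deligne_module R q K := @DeligneModule R p q K 'cV[int]_2
  idfun id idK idK' (mulmx A) (mulmx (adj2 A)) AV VA
  (quadratic_semisimple trA' detA') (quadratic_weil trA' detA')
  (quadratic_ordinary trA' detA') (quadratic_trace trA').
have mxM0 : mxF M0 = A := mxA.
have trQ : \tr (mxFQ M0) = - B%:~R.
  by rewrite /mxFQ mxM0 trace_map_mx trA rmorphN.
have detQ : \det (mxFQ M0) = q%:R by rewrite /mxFQ mxM0 det_map_mx detA.
have formE x y : @formQ R p q K M0 lam_std x y = x 0 0 * y 1 0 - x 1 0 * y 0 0.
  exact: symp_form_gram.
have pol : @is_polarization R p q K v M0 lam_std.
  split.
  - by move=> x y z; rewrite /lam_std !sympE !mxE; ring.
  - by move=> x y z; rewrite /lam_std !sympE !mxE; ring.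
  - by move=> x; rewrite /lam_std sympE; ring.
  - move=> x x_ker; apply: eq_cV2; rewrite mxE.
      by have := x_ker (delta_mx 1 0); rewrite formE !mxE /= mulr1 mulr0 subr0.
    have := x_ker (delta_mx 0 0); rewrite formE !mxE /= mulr1 mulr0 sub0r => /eqP.
    by rewrite oppr_eq0 => /eqP.
  - by move=> x y; rewrite /lam_std /= !sympE !mulmx2E !mx2E; ring.
  - move=> iota conjP posP.
    have [y -> y_om] := (imag_eltP disc_lt0 om_root v_om v_om_conj trQ detQ iota).1
      (conj conjP posP).
    have yA : 0 < y * mxFQ M0 1 0.
      by rewrite /mxFQ mxM0 mxE; apply: sign_transfer.
    split=> x; last by move=> x0; rewrite formE; apply: imag_form_pos.
    by move=> z; rewrite !formE; apply: imag_form_sym.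
have principal : @is_principal R p q K M0 lam_std.
  by move=> f; apply: (lam_std_principal f).
have real : @is_real_structure R p q K M0 lam_std (mulmx tau).
  split.
  - exact: mulmxDr.
  - by move=> x; rewrite mulmxA tau2 mul1mx.
  - by move=> x; rewrite /= !mulmxA tauA.
  - by move=> x y; rewrite /lam_std symp_mulmx det_tau mulN1r.
exists (RealPPDM pol principal real).
  by apply/has_eigenvaluesP; rewrite mxM0.
exists (idfun : {additive 'cV[int]_2 -> _}); split=> //.
by exists id.
Qed.

Lemma num_classes_real_frobenius (tau : 'M[int]_2) (l : seq 'M[int]_2) :
  tau *m tau = 1%:M -> \det tau = -1 -> scalar_centralizer tau ->
  uniq l -> (forall A, A \in l <-> real_frobenius B q s tau A) ->
  num_classes (fun M : real_ppdm q K v =>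
      has_eigenvalues M om om^* /\ corresponds_to tau M)
    (@dm_isom R p q K v) (size l).
Proof.
move=> tau2 det_tau cent l_uniq lP.
pose t i := tnth (in_tuple l) i.
have tP i : real_frobenius B q s tau (t i) by apply/lP/mem_tnth.
pose mk i := real_frobenius_module tau2 det_tau (tP i).
have mk_eig i : has_eigenvalues (s2val (mk i)) om om^* := s2valP (mk i).
have mk_fr i : framed tau (t i) (s2val (mk i)) := s2valP' (mk i).
exists (fun i => s2val (mk i)); split.
- by move=> i; split; [apply: mk_eig | apply: framed_corresponds (mk_fr i)].
- by move=> i j /(isom_framed cent (mk_fr i) (mk_fr j)); apply/tuple_uniqP.
- move=> M [eigM corM].
  have [A /lP Al frM] := corresponds_real_frobenius eigM corM.
  have /tnthP[i AE] : A \in in_tuple l by [].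
  by exists i; apply: framed_isom frM _; rewrite AE; apply: mk_fr.
Qed.

End Modules.

(** * Integral solutions *)

Lemma tau0E : [/\ tau0 0 0 = -1, tau0 0 1 = 0, tau0 1 0 = 0 & tau0 1 1 = 1].
Proof. by split; rewrite mxE. Qed.

Lemma tau1E : [/\ tau1 0 0 = -1, tau1 0 1 = 0, tau1 1 0 = 1 & tau1 1 1 = 1].
Proof. by split; rewrite mxE. Qed.

Lemma tau0_involutive : tau0 *m tau0 = 1%:M.
Proof. by apply: eq_mx2; rewrite mulmx2E !mxE. Qed.

Lemma tau1_involutive : tau1 *m tau1 = 1%:M.
Proof. by apply: eq_mx2; rewrite mulmx2E !mxE. Qed.

Lemma det_tau0 : \det tau0 = -1.
Proof. by rewrite det2 !mxE. Qed.

Lemma det_tau1 : \det tau1 = -1.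
Proof. by rewrite det2 !mxE. Qed.

Lemma mulz_eq1_eq (a b : int) : a * b = 1 -> a = b.
Proof.
move=> ab; have /eqP : absz (a * b) = 1%N by rewrite ab.
rewrite abszM muln_eq1 => /andP[/eqP a1 /eqP b1].
have [aE|aE] : a = 1 \/ a = -1 by lia.
  by move: ab; rewrite aE mul1r => ->.
by move: ab; rewrite aE; lia.
Qed.

Lemma scalar_centralizer_tau0 : scalar_centralizer tau0.
Proof.
move=> N /matrixP comm; have := comm 0 1; have := comm 1 0.
rewrite det2 !mulmx2E; have [-> -> -> ->] := tau0E.
move Ea: (N 0 0) => a; move Eb: (N 0 1) => b.
move Ec: (N 1 0) => c; move Ed: (N 1 1) => d.
move=> e10 e01 detN; have b0 : b = 0 by lia.
have c0 : c = 0 by lia.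
rewrite b0 mul0r subr0 in detN; have ad := esym (mulz_eq1_eq detN).
exists a; first by apply: contra_eq_neq detN => ->; rewrite mul0r.
by apply: eq_mx2; rewrite ?Ea ?Eb ?Ec ?Ed mxE ?b0 ?c0 ?ad.
Qed.

Lemma scalar_centralizer_tau1 : scalar_centralizer tau1.
Proof.
move=> N /matrixP comm; have := comm 0 0; have := comm 1 0.
rewrite det2 !mulmx2E; have [-> -> -> ->] := tau1E.
move Ea: (N 0 0) => a; move Eb: (N 0 1) => b.
move Ec: (N 1 0) => c; move Ed: (N 1 1) => d.
move=> e10 e00 detN; have b0 : b = 0 by lia.
rewrite b0 mul0r subr0 in detN; have ad := esym (mulz_eq1_eq detN).
have c0 : c = 0 by lia.
exists a; first by apply: contra_eq_neq detN => ->; rewrite mul0r.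
by apply: eq_mx2; rewrite ?Ea ?Eb ?Ec ?Ed mxE ?b0 ?c0 ?ad.
Qed.

(** * Real Frobenius matrices as factorizations of the discriminant *)

Section Solutions.
Variables (B s : int) (q : nat).
Hypothesis s1 : s = 1 \/ s = -1.

(** Conjugation by [tau0] negates the off-diagonal entries, as [adj2] does, so only the equality of
    the diagonal entries remains. *)
Lemma real_frobenius_tau0P (A : 'M[int]_2) : real_frobenius B q s tau0 A <->
  [/\ A 1 1 = A 0 0, 2 * A 0 0 = - B, A 0 0 ^+ 2 - A 0 1 * A 1 0 = q
    & 0 < s * A 1 0].
Proof.
have [t00 t01 t10 t11] := tau0E.
have -> : real_frobenius B q s tau0 A <-> [/\ A 1 1 = A 0 0,
    A 0 0 + A 1 1 = - B, A 0 0 * A 1 1 - A 0 1 * A 1 0 = q & 0 < s * A 1 0].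
  rewrite /real_frobenius tr_mx2 det2.
  split=> -[E trA detA sA]; split=> //.
    move/matrixP: E => /(_ 0 0); rewrite !mulmx2E mx2E ?t00 ?t01 ?t10 ?t11.
    by do 4!move: (A _ _) => ?; lia.
  apply: eq_mx2; rewrite !mulmx2E mx2E ?t00 ?t01 ?t10 ?t11 ?E;
  by do ?move: (A _ _) => ?; lia.
do 4!move: (A _ _) => ?; split=> -[-> ? ? ?]; split=> //; lia.
Qed.

(** For entries a, b, c, d the matrix equation amounts to d = a - b; then B = b - 2 a and B^2 - 4 q
    = (b - 2 a)^2 - 4 (a (a - b) - b c) = b (b + 4 c). *)
Lemma real_frobenius_tau1P (A : 'M[int]_2) : real_frobenius B q s tau1 A <->
  [/\ A 1 1 = A 0 0 - A 0 1, 2 * A 0 0 = A 0 1 - B,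
      A 0 1 * (A 0 1 + 4 * A 1 0) = B ^+ 2 - 4 * q%:Z & 0 < s * A 1 0].
Proof.
have [t00 t01 t10 t11] := tau1E.
have -> : real_frobenius B q s tau1 A <-> [/\ A 1 1 = A 0 0 - A 0 1,
    A 0 0 + A 1 1 = - B, A 0 0 * A 1 1 - A 0 1 * A 1 0 = q & 0 < s * A 1 0].
  rewrite /real_frobenius tr_mx2 det2.
  split=> -[E trA detA sA]; split=> //.
    move/matrixP: E => /(_ 0 0); rewrite !mulmx2E mx2E ?t00 ?t01 ?t10 ?t11.
    by do 4!move: (A _ _) => ?; lia.
  apply: eq_mx2; rewrite !mulmx2E mx2E ?t00 ?t01 ?t10 ?t11 ?E;
  by do ?move: (A _ _) => ?; lia.
move: (A 0 0) (A 0 1) (A 1 0) (A 1 1) => a b c d.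
split=> -[-> tr det sc].
  have BE : B = b - 2 * a by lia.
  by split=> //; rewrite ?BE -?det; ring.
have BE : B = b - 2 * a by lia.
by split=> //; [rewrite BE; ring | rewrite BE in det; lia].
Qed.

(** For B = - 2 k and D = - 4 n: the divisor d is the absolute value of A10, and [s] puts the signs
    so that A01 A10 = - n. *)
Definition sol0 (k : int) (n d : nat) : 'M[int]_2 :=
  mx2 k (- (s * (n %/ d)%N)) (s * d) k.

Lemma sol0P (k : int) (n d : nat) : B = - (2 * k) -> q = k ^+ 2 + n :> int ->
  (0 < n)%N -> d \in divisors n -> real_frobenius B q s tau0 (sol0 k n d).
Proof.
move=> Bk qk n_gt0; rewrite -dvdn_divisors // => dn.
have d_gt0 := dvdn_gt0 n_gt0 dn; have := divnK dn.
move: (n %/ d)%N => e en; apply/real_frobenius_tau0P; rewrite /sol0 !mx2E.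
split=> //; first by rewrite Bk opprK.
  by rewrite qk -en mulnK //; case: s1 => ->; lia.
by case: s1 => ->; lia.
Qed.

Lemma sol0_inj (k : int) (n d d' : nat) : sol0 k n d = sol0 k n d' -> d = d'.
Proof.
move=> /matrixP/(_ 1 0); rewrite !mx2E; case: s1 => ->; lia.
Qed.

Lemma sol0_surj (k : int) (n : nat) (A : 'M[int]_2) :
  B = - (2 * k) -> q = k ^+ 2 + n :> int -> (0 < n)%N ->
  real_frobenius B q s tau0 A ->
  exists2 d, d \in divisors n & A = sol0 k n d.
Proof.
move=> Bk qk n_gt0 /real_frobenius_tau0P[A11 A00 detA sA].
have {}A00 : A 0 0 = k by move: A00; move: (A 0 0) => a; lia.
rewrite A00 qk in detA A11; move: detA sA; move Eb: (A 0 1) => b.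
move Ec: (A 1 0) => c detA sA; pose d := `|c|%N; pose e := `|b|%N.
have dE : c = s * d by rewrite /d; case: s1 sA => ->; lia.
have d_gt0 : (0 < d)%N by case: s1 sA => s_eq; rewrite dE s_eq; lia.
have prod : b * (s * d%:Z) = - n%:Z by rewrite -dE; lia.
have eE : b = - (s * e).
  have : b * s < 0 by rewrite -(pmulr_llt0 _ (_ : 0 < d%:Z)) //; nia.
  by rewrite /e; case: s1 => ->; lia.
have ed : n = (e * d)%N by move: prod; rewrite eE; case: s1 => ->; lia.
exists d; first by rewrite -dvdn_divisors // ed dvdn_mull.
by apply: eq_mx2; rewrite /sol0 !mx2E ?A11 ?A00 ?Eb ?Ec // ed mulnK.
Qed.

(** Here d and e are the absolute values of A01 and A01 + 4 A10. These have opposite signs, so A10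
    has absolute value (d + e) / 4; the trace gives a = (b - B) / 2. *)
Definition sol1 (d e : nat) : 'M[int]_2 :=
  let b := - (s * d) in let a := ((b - B) %/ 2)%Z in
  mx2 a b (s * ((d + e) %/ 4)%N) (a - b).

Lemma sol1P (d e : nat) : (0 < d)%N -> (4 %| d + e)%N ->
  B ^+ 2 - 4 * q%:Z = - (d * e)%N%:Z ->
  real_frobenius B q s tau1 (sol1 d e).
Proof.
move=> d_gt0 /dvdnP[w dew] DE; apply/real_frobenius_tau1P; rewrite /sol1 !mx2E.
rewrite dew mulnK //; have eE : e%:Z = 4 * w%:Z - d%:Z by lia.
rewrite DE PoszM eE; have w_gt0 : (0 < w)%N by lia.
(* The division by 2 in [sol1] is exact: B^2 - d^2 = 4 (q - d w), while B - d and B + d have the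
   same parity, so both are even. *)
have B_par : (2 %| - (s * d) - B)%Z.
  have : (4 %| (B - d%:Z) * (B + d%:Z))%Z.
    apply/dvdzP; exists (q%:Z - d%:Z * w).
    by move: DE; rewrite PoszM eE; nia.
  have : exists k r : int, B - d%:Z = 2 * k + r /\ (r = 0 \/ r = 1).
    by exists ((B - d%:Z) %/ 2)%Z, ((B - d%:Z) %% 2)%Z; lia.
  case=> k [r [kr r01]]; have -> : B + d%:Z = 2 * k + r + 2 * d%:Z by lia.
  rewrite kr => /dvdzP[t tE].
  have r0 : r = 0 by case: r01 => // r1; subst r; nia.
  by apply/dvdzP; case: s1 => ->; [exists (- k - d%:Z) | exists (- k)]; lia.
split=> //.
- by move/dvdzP: B_par => [t ->]; rewrite mulzK // mulrC.
- by case: s1 => ->; ring.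
- by case: s1 => ->; lia.
Qed.

Lemma sol1_inj (d e d' e' : nat) : sol1 d e = sol1 d' e' -> d = d'.
Proof.
move=> /matrixP/(_ 0 1); rewrite !mx2E; case: s1 => ->; lia.
Qed.

Lemma sol1_surj (A : 'M[int]_2) : B ^+ 2 < 4 * q%:Z ->
  real_frobenius B q s tau1 A ->
  exists d e : nat, [/\ (0 < d)%N, (4 %| d + e)%N,
    B ^+ 2 - 4 * q%:Z = - (d * e)%N%:Z & A = sol1 d e].
Proof.
move=> disc /real_frobenius_tau1P[A11 A00 prod sA].
move: prod sA A11 A00; move Ea: (A 0 0) => a; move Eb: (A 0 1) => b.
move Ec: (A 1 0) => c; move Ed: (A 1 1) => a' prod sc d11 a00.
(* If s b >= 0, then b and b + 4 c would have a nonnegative product, against D < 0. The same sign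
   argument gives s (b + 4 c) > 0. *)
have sb : s * b < 0 by case: s1 sc => ->; nia.
pose d := `|b|%N; pose e := absz (b + 4 * c).
have dE : b = - (s * d) by rewrite /d; case: s1 sb => ->; lia.
have eE : b + 4 * c = s * e by rewrite /e; case: s1 sb sc prod => ->; nia.
have deE : (d + e)%N = (`|c| * 4)%N by case: s1 dE eE sc => ->; lia.
exists d, e; split.
- by case: s1 sb => ->; lia.
- by rewrite deE dvdn_mull.
- by rewrite -prod {1}dE eE; case: s1 => ->; lia.
- rewrite /sol1 -dE -a00 mulKz // deE mulnK //.
  apply: eq_mx2; rewrite !mx2E ?Ea ?Eb ?Ec ?Ed //.
  by case: s1 sc => ->; lia.
Qed.

Lemma real_frobenius_list (tau : 'M[int]_2) (L : eqType) (l : seq L)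
    (f : L -> 'M[int]_2) :
  uniq l -> {in l, forall x, real_frobenius B q s tau (f x)} ->
  {in l &, injective f} ->
  (forall A, real_frobenius B q s tau A -> exists2 x, x \in l & A = f x) ->
  exists l' : seq 'M[int]_2, [/\ size l' = size l, uniq l'
    & forall A, A \in l' <-> real_frobenius B q s tau A].
Proof.
move=> l_uniq fP f_inj f_surj; exists (map f l); rewrite size_map map_inj_in_uniq //.
by split=> // A; split=> [/mapP[x xl ->]|/f_surj[x xl ->]]; [apply: fP | apply: map_f].
Qed.

Lemma real_frobenius_tau0_even (k : int) (n : nat) :
  B = - (2 * k) -> q = k ^+ 2 + n :> int -> (0 < n)%N ->
  exists l : seq 'M[int]_2, [/\ size l = sigma0 n, uniq l
    & forall A, A \in l <-> real_frobenius B q s tau0 A].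
Proof.
move=> Bk qk n_gt0; apply: (@real_frobenius_list _ _ _ (sol0 k n)).
- exact: divisors_uniq.
- by move=> d; apply: sol0P.
- by move=> d d' _ _; apply: sol0_inj.
- by move=> A; apply: sol0_surj.
Qed.

Lemma not_real_frobenius_tau0 (A : 'M[int]_2) :
  (B ^+ 2 - 4 * q%:Z <> 0 %[mod 4])%Z -> ~ real_frobenius B q s tau0 A.
Proof.
move=> D0 /real_frobenius_tau0P[_]; move: (A 0 0) => a BE _ _; case: D0.
have -> : B = - (2 * a) by rewrite BE opprK.
have -> : (- (2 * a)) ^+ 2 - 4 * q%:Z = (a ^+ 2 - q%:Z) * 4 by ring.
by rewrite modzMl.
Qed.

(** One factor is 1 and the other 3 modulo 4. Hence every divisor of -D is admissible when D = 1
    modulo 4. *)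
Lemma dvd4_add_of_mul_mod4 (d e : nat) : (d * e = 3 %[mod 4])%N -> (4 %| d + e)%N.
Proof.
rewrite -modnMm /dvdn -modnDm.
have := ltn_pmod d (isT : (0 < 4)%N); have := ltn_pmod e (isT : (0 < 4)%N).
by case: (d %% 4)%N => [|[|[|[|]]]] //; case: (e %% 4)%N => [|[|[|[|]]]].
Qed.

Lemma real_frobenius_tau1_odd (n : nat) :
  B ^+ 2 - 4 * q%:Z = - n%:Z -> (n = 3 %[mod 4])%N ->
  exists l : seq 'M[int]_2, [/\ size l = sigma0 n, uniq l
    & forall A, A \in l <-> real_frobenius B q s tau1 A].
Proof.
move=> DE n3; have n_gt0 : (0 < n)%N by case: n n3 {DE}.
have disc : B ^+ 2 < 4 * q%:Z by rewrite -subr_lt0 DE oppr_lt0.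
apply: (@real_frobenius_list _ _ _ (fun d => sol1 d (n %/ d)%N)).
- exact: divisors_uniq.
- move=> d; rewrite -dvdn_divisors // => dn; have ed := divnK dn.
  apply: sol1P; first exact: dvdn_gt0 dn.
    by apply: dvd4_add_of_mul_mod4; rewrite mulnC ed.
  by rewrite DE [(d * _)%N]mulnC ed.
- by move=> d d' _ _; apply: sol1_inj.
- move=> A /(sol1_surj disc)[d [e [d_gt0 _ de ->]]].
  have nE : n = (d * e)%N.
    by move: de; rewrite DE => /oppr_inj[].
  by exists d; rewrite -?dvdn_divisors // nE ?dvdn_mulr // mulKn.
Qed.

(** An even sum gives d and e equal parity, and an even product makes both even; after halving, 4 |
    d + e becomes 2 | u + w. *)
Lemma dvd4_add_even (d e n : nat) : (4 %| d + e)%N -> (d * e = 4 * n)%N ->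
  exists u w, [/\ d = (2 * u)%N, e = (2 * w)%N, (u * w = n)%N & odd u = odd w].
Proof.
move=> de4 nE.
have par : odd d = odd e.
  case/dvdnP: de4 => t /(congr1 odd); rewrite oddD oddM andbF.
  by case: (odd d); case: (odd e).
have d_even : ~~ odd d.
  by have := congr1 odd nE; rewrite !oddM -par andbb => ->.
have e_even : ~~ odd e by rewrite -par.
have dE : d = (2 * d./2)%N by rewrite mul2n even_halfK.
have eE : e = (2 * e./2)%N by rewrite mul2n even_halfK.
exists d./2, e./2; split=> //.
  by apply/eqP; rewrite -(@eqn_pmul2l 4) // -nE {2}dE {2}eE mulnACA.
move: de4; rewrite dE eE -mulnDr (@dvdn_pmul2l 2 2) // dvdn2 oddD.
by rewrite -dE -eE; case: (odd d./2); case: (odd e./2).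
Qed.

Lemma real_frobenius_tau1_even (n : nat) :
  B ^+ 2 - 4 * q%:Z = - (4 * n%:Z) -> (0 < n)%N ->
  exists l : seq 'M[int]_2, [/\ size l = sigma0' n, uniq l
    & forall A, A \in l <-> real_frobenius B q s tau1 A].
Proof.
move=> DE n_gt0.
have disc : B ^+ 2 < 4 * q%:Z by rewrite -subr_lt0 DE oppr_lt0 mulr_gt0.
rewrite /sigma0' cardE.
apply: (@real_frobenius_list _ _ _
  (fun uw : 'I_n.+1 * 'I_n.+1 => sol1 (2 * uw.1) (2 * uw.2))).
- exact: enum_uniq.
- move=> [u w]; rewrite mem_enum inE /= => /and4P[u_gt0 w_gt0 /eqP uw /eqP par].
  apply: sol1P; first by rewrite muln_gt0.
    by rewrite -mulnDr (@dvdn_pmul2l 2 2) // dvdn2 oddD par addbb.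
  by rewrite DE mulnACA uw.
- move=> [u w] [u' w']; rewrite !mem_enum !inE /= => /and4P[u_gt0 _ /eqP uw _].
  move=> /and4P[_ _ /eqP uw' _] /sol1_inj /eqP; rewrite eqn_pmul2l // => /eqP uu.
  have {}uu : u = u' by apply: val_inj.
  subst u'; congr pair; apply: val_inj => /=; apply/eqP.
  by rewrite -(eqn_pmul2l u_gt0) uw uw'.
- move=> A /(sol1_surj disc)[d [e [d_gt0 de4 de ->]]].
  have [|u [w [dE eE uw par]]] := @dvd4_add_even _ _ n de4.
    by move: de; rewrite DE => /oppr_inj[].
  have [u_gt0 w_gt0] : (0 < u)%N /\ (0 < w)%N.
    by apply/andP; rewrite -muln_gt0 uw.
  have u_le : (u < n.+1)%N by rewrite ltnS -uw leq_pmulr.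
  have w_le : (w < n.+1)%N by rewrite ltnS -uw leq_pmull.
  exists (Ordinal u_le, Ordinal w_le); last by rewrite dE eE.
  by rewrite mem_enum inE /= u_gt0 w_gt0 uw par !eqxx.
Qed.

End Solutions.

(** * Residues of the discriminant modulo 4 and the final count *)

Lemma num_classes_ext (X : Type) (P P' : X -> Prop) (iso : X -> X -> Prop) n :
  (forall x, P x <-> P' x) -> num_classes P iso n -> num_classes P' iso n.
Proof.
by move=> PP' [f [fP fI fS]]; exists f; split=> // [i|x /PP'/fS//]; apply/PP'.
Qed.

Lemma mod4_discr (B : int) (q : nat) :
  (exists k, B = - (2 * k)) \/ (B ^+ 2 - 4 * q%:Z = 1 %[mod 4])%Z.
Proof.
have [k [kE|kE]] : exists k, B = 2 * k \/ B = 2 * k + 1.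
  by exists (B %/ 2)%Z; lia.
  by left; exists (- k); lia.
right; rewrite kE.
have -> : (2 * k + 1) ^+ 2 - 4 * q%:Z = (k ^+ 2 + k - q%:Z) * 4 + 1 by ring.
by rewrite modzMDl.
Qed.

Lemma even_discr (B k : int) (q n : nat) : B = - (2 * k) ->
  B ^+ 2 - 4 * q%:Z = - (4 * n%:Z) -> q = k ^+ 2 + n :> int.
Proof. by move=> ->; lia. Qed.

Lemma divz4_neg (D : int) : (D = 0 %[mod 4])%Z -> D < 0 ->
  (0 < `|(- D %/ 4)%Z|)%N /\ D = - (4 * `|(- D %/ 4)%Z|%N%:Z).
Proof. by lia. Qed.

Lemma absz_mod4 (D : int) : (D = 1 %[mod 4])%Z -> D < 0 ->
  D = - `|- D|%N%:Z /\ (`|- D| = 3 %[mod 4])%N.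
Proof. by lia. Qed.

Theorem propositionF5 (R : realType) (p m : nat) (p_prime : prime p)
    (m_gt0 : (0 < m)%N) (q : nat) (q_def : q = (p ^ m)%N)
    (K : padic_closure p) (E : witt_embedding R p q)
    (v : R[i] -> rat) (v_val : is_val_p E v)
    (pi : R[i]) (B D : int)
    (pi_weil : weil_number q pi)
    (pi_eq : pi ^+ 2 + B%:~R * pi + q%:R = 0)
    (B_ndvd : ~~ (p %| B)%Z)
    (D_def : D = B ^+ 2 - 4 * q%:Z)
    (D_lb : - (4 * q%:Z) < D) (D_lt0 : D < 0) :
  let count (tau : 'M[int]_2) (n : nat) :=
    num_classes
      (fun M : real_ppdm q K v =>
         has_eigenvalues M pi (pi^*) /\ corresponds_to tau M)
      (@dm_isom R p q K v) n in
  [/\ (D = 0 %[mod 4])%Z -> count tau0 (sigma0 `|(- D %/ 4)%Z|%N),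
      (D <> 0 %[mod 4])%Z -> count tau0 0%N,
      (D = 1 %[mod 4])%Z -> count tau1 (sigma0 `|- D|%N)
    & (D = 0 %[mod 4])%Z -> count tau1 (sigma0' `|(- D %/ 4)%Z|%N)].
Proof.
move=> count; subst q.
have disc : B ^+ 2 < 4 * (p ^ m)%N%:Z by rewrite -subr_lt0 -D_def.
have [piD piM _] := quadratic_root_conj disc pi_eq.
(* The eigenvalue of positive valuation may be [pi] or its conjugate; the eigenvalue condition is
   symmetric in the two. *)
have [om [om_root v_om v_om_conj eigE]] : exists om : R[i],
    [/\ om ^+ 2 + B%:~R * om + (p ^ m)%N%:R = 0, 0 < v om, ~~ (0 < v om^*)
      & forall M : real_ppdm (p ^ m) K v,
        has_eigenvalues M om om^* <-> has_eigenvalues M pi pi^*].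
  have := val_ordinary_roots v_val p_prime m_gt0 B_ndvd piD piM.
  case v_pi: (0 < v pi); case v_pi': (0 < v pi^*) => // _.
    by exists pi; rewrite v_pi v_pi'.
  exists pi^*; rewrite conjCK v_pi v_pi'; split=> //.
    by apply/(quadratic_rootP disc _ pi_eq); right.
  move=> M; split=> eigM z; split.
  - by move=> /eigM[]; [right|left].
  - by move=> zE; apply/eigM; case: zE; [right|left].
  - by move=> /eigM[]; [right|left].
  - by move=> zE; apply/eigM; case: zE; [right|left].
have [_ _ om_im] := quadratic_root_conj disc om_root.
have [s s1 s_om] : exists2 s : int, s = 1 \/ s = -1
    & 0 < s%:~R * complex.Im om.
  have [om_gt0|om_lt0|om0] := ltgtP (complex.Im om) 0.
  - by exists (-1); [right | rewrite mulrNz mulN1r oppr_gt0].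
  - by exists 1; [left | rewrite mul1r].
  - by rewrite om0 eqxx in om_im.
have s2 : s ^+ 2 = 1 by case: s1 => ->.
have num tau (l : seq 'M[int]_2) tau2 det_tau cent l_uniq lP
    : count tau (size l) :=
  num_classes_ext (fun M => and_iff_compat_r _ (eigE M))
    (@num_classes_real_frobenius R p m K v B s om p_prime m_gt0 B_ndvd disc
       om_root v_om v_om_conj s2 s_om tau l tau2 det_tau cent l_uniq lP).
have num0 := num _ _ tau0_involutive det_tau0 scalar_centralizer_tau0.
have num1 := num _ _ tau1_involutive det_tau1 scalar_centralizer_tau1.
split=> [D0|D0|D1|D0].
- have [n_gt0 DE] := divz4_neg D0 D_lt0; move: DE n_gt0; set n := absz _.
  (* B is even here, because an odd B gives D = 1 modulo 4. *)
  move=> DE n_gt0; have [[k kE]|] := mod4_discr B (p ^ m); last by rewrite -D_def D0.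
  have qE := even_discr kE (etrans (esym D_def) DE).
  have [l [<- l_uniq lP]] := real_frobenius_tau0_even s1 kE qE n_gt0.
  exact: num0 l_uniq lP.
- apply: (num0 [::]) => // A; split=> // /not_real_frobenius_tau0[//|].
  by rewrite -D_def.
- have [DE n3] := absz_mod4 D1 D_lt0.
  have [l [<- l_uniq lP]] :=
    real_frobenius_tau1_odd s1 (etrans (esym D_def) DE) n3.
  exact: num1 l_uniq lP.
- have [n_gt0 DE] := divz4_neg D0 D_lt0.
  have [l [<- l_uniq lP]] :=
    real_frobenius_tau1_even s1 (etrans (esym D_def) DE) n_gt0.
  exact: num1 l_uniq lP.
Qed.
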